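(* Let $K$ be any field, and let $G$ be a transitive subgroup of the symmetric group $S_6$ which contains a subgroup isomorphic to $C_3 \times C_3$. If $G \neq A_6$, then the fixed field $K(x_1,\dots,x_6)^G$ is rational over $K$.
   Context: $x_1,\dots,x_6$ are independent variables over $K$, and $K(x_1,\dots,x_6)$ is the rational function field. The group $S_6$ (and hence any subgroup $G$) acts on $K(x_1,\dots,x_6)$ by $K$-automorphisms permuting the variables: $\sigma(x_i)=x_{\sigma(i)}$, with trivial action on $K$. $K(x_1,\dots,x_6)^G$ denotes the subfield of $G$-invariants. A field extension of $K$ is called rational over $K$ if it is purely transcendental over $K$, i.e. generated over $K$ by (finitely many) algebraically independent elements. $C_3$ is the cyclic group of order 3, and $A_6$ is the alternating subgroup of $S_6$. *)

(* Defs.v *)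
From HB Require Import structures.
From mathcomp Require Import all_boot all_order all_fingroup all_algebra all_solvable.
From mathcomp Require Import generic_quotient.
From mathcomp.multinomials Require Import mpoly.

Set Implicit Arguments.
Unset Strict Implicit.
Unset Printing Implicit Defensive.

Import GRing.Theory.
Local Open Scope ring_scope.
Local Open Scope quotient_scope.

Notation "x %:F" := (FracField.tofrac x) : ring_scope.

(* The variables x_1, ..., x_n are 'X_i with i : 'I_n, hence numbered from 0. *)
Notation ratfun K n := {fraction {mpoly K[n]}}.

Definition ratC (K : fieldType) (n : nat) : K -> ratfun K n :=
  @FracField.tofrac {mpoly K[n]} \o @mpolyC n K.
Arguments ratC : clear implicits.

HB.instance Definition _ (K : fieldType) (n : nat) :=
  GRing.RMorphism.copy (ratC K n) (@FracField.tofrac {mpoly K[n]} \o @mpolyC n K).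

Section PermutationOfVariables.

Variables (K : fieldType) (n : nat).
Implicit Types (s : 'S_n) (p q : {mpoly K[n]}) (f g : ratfun K n).

(* [msym s] is the K-algebra endomorphism 'X_i |-> 'X_(s i) of the polynomial
   ring; [ratperm_fracE] below shows that the chosen representative of f is
   irrelevant. *)
Definition ratperm s f : ratfun K n :=
  (msym s \n_(repr f))%:F / (msym s \d_(repr f))%:F.

Lemma msym_eq0 s p : (msym s p == 0) = (p == 0).
Proof. by rewrite -[RHS](inj_eq (@inj_msym _ _ s)) msym0. Qed.

Lemma ratfun_reprE f : f = (\n_(repr f))%:F / (\d_(repr f))%:F.
Proof.
have d0 : (\d_(repr f))%:F != 0 :> ratfun K n by rewrite tofrac_eq0 denom_ratioP.
apply: (mulIf d0); rewrite divfK //.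
rewrite -[f in LHS]reprK; unlock FracField.tofrac.
rewrite -[LHS]FracField.pi_mul; apply/eqmodP; rewrite /= FracField.equivfE.
rewrite /FracField.mulf !numden_Ratio ?mulf_neq0 ?oner_neq0 ?denom_ratioP //.
by rewrite !mulr1 reprK mulrC.
Qed.

Lemma ratperm_fracE s p q :
  q != 0 -> ratperm s (p%:F / q%:F) = (msym s p)%:F / (msym s q)%:F.
Proof.
move=> q0; rewrite /ratperm; set f := p%:F / q%:F.
have d0 : \d_(repr f) != 0 := denom_ratioP _.
apply/eqP; rewrite eqr_div ?tofrac_eq0 ?msym_eq0 //.
rewrite -!tofracM tofrac_eq -!msymM (inj_eq (@inj_msym _ _ s)) -tofrac_eq !tofracM.
rewrite -eqr_div ?tofrac_eq0 //.
exact/eqP/esym/ratfun_reprE.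
Qed.

Lemma ratperm_tofrac s p : ratperm s p%:F = (msym s p)%:F.
Proof.
by rewrite -[p%:F]divr1 -tofrac1 ratperm_fracE ?oner_neq0 // msym1 tofrac1 divr1.
Qed.

Lemma ratpermX s i : ratperm s ('X_i)%:F = ('X_(s i))%:F.
Proof. by rewrite ratperm_tofrac /msym mmapX mmap1U. Qed.

Lemma ratpermC s c : ratperm s (ratC K n c) = ratC K n c.
Proof. by rewrite ratperm_tofrac /msym mmapC. Qed.

Lemma ratperm_is_zmod_morphism s : zmod_morphism (ratperm s).
Proof.
move=> f g; rewrite [f]ratfun_reprE [g]ratfun_reprE.
set p := \n_(repr f); set q := \d_(repr f).
set p' := \n_(repr g); set q' := \d_(repr g).
have q0 : q != 0 := denom_ratioP _; have q'0 : q' != 0 := denom_ratioP _.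
rewrite -mulNr addf_div ?tofrac_eq0 // -tofracN -!tofracM -tofracD.
rewrite !ratperm_fracE ?mulf_neq0 // -mulNr.
rewrite addf_div ?tofrac_eq0 ?msym_eq0 //.
by rewrite msymD !msymM msymN !(tofracM, tofracN, tofracD).
Qed.

Lemma ratperm_is_monoid_morphism s : monoid_morphism (ratperm s).
Proof.
split=> [|f g]; first by rewrite -tofrac1 ratperm_tofrac msym1.
rewrite [f]ratfun_reprE [g]ratfun_reprE.
set p := \n_(repr f); set q := \d_(repr f).
set p' := \n_(repr g); set q' := \d_(repr g).
have q0 : q != 0 := denom_ratioP _; have q'0 : q' != 0 := denom_ratioP _.
rewrite mulf_div -!tofracM !ratperm_fracE ?mulf_neq0 // mulf_div.
by rewrite !msymM !tofracM.
Qed.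

HB.instance Definition _ s := GRing.isZmodMorphism.Build
  (ratfun K n) (ratfun K n) (ratperm s) (ratperm_is_zmod_morphism s).
HB.instance Definition _ s := GRing.isMonoidMorphism.Build
  (ratfun K n) (ratfun K n) (ratperm s) (ratperm_is_monoid_morphism s).

End PermutationOfVariables.

Definition fixed_ratfun (K : fieldType) (n : nat) (G : {set 'S_n}) :
    {pred ratfun K n} :=
  [pred f | [forall s in G, ratperm s f == f]].
Arguments fixed_ratfun K {n} G.

Section RationalExtension.

Variables (K L : fieldType) (iota : {rmorphism K -> L}).

(* The subfield iota(K)(t_0, ..., t_{n-1}) of L. *)
Inductive generated_field (n : nat) (t : 'I_n -> L) : L -> Prop :=
| generated_const c : generated_field t (iota c)
| generated_var i : generated_field t (t i)
| generated_sub f g :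
    generated_field t f -> generated_field t g -> generated_field t (f - g)
| generated_div f g :
    generated_field t f -> generated_field t g -> generated_field t (f / g).

Definition algebraically_independent (n : nat) (t : 'I_n -> L) : Prop :=
  forall p : {mpoly K[n]}, mmap iota t p = 0 -> p = 0.

(* E, a subset of L, is a purely transcendental extension of iota(K) of finite
   transcendence degree; in particular E is then a subfield of L. *)
Definition rational_over (E : {pred L}) : Prop :=
  exists (n : nat) (t : 'I_n -> L),
    algebraically_independent t /\ (forall f, f \in E <-> generated_field t f).

End RationalExtension.

(* Main.v *)
Require Import Defs.
From HB Require Import structures.
From mathcomp Require Import all_boot all_order all_fingroup all_algebra all_solvable.
From mathcomp.multinomials Require Import mpoly.
From mathcomp Require Import boolp ring.

Set Implicit Arguments.
Unset Strict Implicit.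
Unset Printing Implicit Defensive.

Import GRing.Theory.
Local Open Scope ring_scope.

(** Write N for the group generated by the three-cycles (0 1 2) and (3 4 5).

    The groups.  C3 x C3 has order 9, so it is a Sylow 3-subgroup of S_6 and, up
    to conjugation, G contains N.  If an element of G breaks the partition
    {0,1,2 | 3,4,5}, then G contains a third three-cycle that meets both blocks,
    hence all three-cycles, and G is A_6 or S_6.  Otherwise G is generated by N
    and its intersection with the dihedral group of order 8 spanned by
    flip1 = (0 1), flip2 = (3 4) and swap = (0 3)(1 4)(2 5); transitivity leaves
    five groups ([transitive_classification]).

    The fields.  For S_6 this is the fundamental theorem of symmetric
    polynomials.  In the other cases N goes first: Masuda's invariants u, v of the
    rotation of three variables, with their sum s, generate its fixed field in
    every characteristic, and a transposition exchanges u and v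
    ([masuda_generators]).  So the fixed field of N is K(u1, v1, u2, v2, s1, s2),
    where flip1 exchanges u1 and v1, flip2 exchanges u2 and v2, and swap exchanges
    the two blocks.  On these six elements G / N acts by permutations, as a group
    of order 2 ([pair_generators], for two of the five groups), as a Klein group
    ([V4_generators]), as a cyclic group of order 4 ([C4_generators]) or as the
    dihedral group ([D4_generators]).  In each case six generators of the fixed
    field are given by formulas valid in every characteristic.

    Generation is always proved in the same way, along a tower of cyclic
    extensions E(b) / E of degree 2 or 3: an element of E(b) is a polynomial in b
    of degree smaller than the number of conjugates of b, and if it is fixed by
    the automorphism, then that polynomial takes the same value at all these
    conjugates, so it is constant ([fixed_descent]).

    Algebraic independence never has to be checked on formulas.  The variables
    are algebraic over the fixed field, so six elements generating it form a
    spanning family with as many elements as there are variables, and by the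
    exchange theorem of Steinitz such a family is independent
    ([rational_of_generators]).  The same argument applied to N shows that
    u1, v1, u2, v2, s1, s2 are independent, which is why the denominators in the
    formulas do not vanish. *)

(** * Adjunction, algebraic elements and exchange *)

Section Adjunction.

Variable L : fieldType.
Implicit Types (E : {pred L}) (s : seq L).

Inductive adjoined E s : L -> Prop :=
| adjoined_base x : x \in E -> adjoined E s x
| adjoined_gen x : x \in s -> adjoined E s x
| adjoined1 : adjoined E s 1
| adjoinedB x y : adjoined E s x -> adjoined E s y -> adjoined E s (x - y)
| adjoined_div x y : adjoined E s x -> adjoined E s y -> adjoined E s (x / y).

(** Boolean, so that the generated subfield is a [divringClosed] predicate and the
    [rpred] lemmas apply to it. *)
Definition adjoin E s : {pred L} := fun x => `[< adjoined E s x >].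

Lemma adjoinP E s x : reflect (adjoined E s x) (x \in adjoin E s).
Proof. exact: asboolP. Qed.

Fact adjoin_divring_closed E s : divring_closed (adjoin E s).
Proof.
split=> [|x y /adjoinP Ex /adjoinP Ey|x y /adjoinP Ex /adjoinP Ey];
  apply/adjoinP.
- exact: adjoined1.
- exact: adjoinedB.
- exact: adjoined_div.
Qed.
HB.instance Definition _ E s :=
  GRing.isDivringClosed.Build L (adjoin E s) (adjoin_divring_closed E s).

Lemma sub_adjoin E s : {subset E <= adjoin E s}.
Proof. by move=> x Ex; apply/adjoinP/adjoined_base. Qed.

Lemma mem_adjoin E s : {subset s <= adjoin E s}.
Proof. by move=> x sx; apply/adjoinP/adjoined_gen. Qed.

Lemma adjoin_min E s (F : divringClosed L) :
  {subset E <= F} -> {subset s <= F} -> {subset adjoin E s <= F}.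
Proof.
move=> EF sF x /adjoinP; elim=> {x} [x /EF|x /sF||x y _ Fx _ Fy|x y _ Fx _ Fy] //.
- exact: rpred1.
- exact: rpredB.
- exact: rpred_div.
Qed.

Lemma adjoin_sub E s E' s' :
    {subset E <= adjoin E' s'} -> {subset s <= adjoin E' s'} ->
  {subset adjoin E s <= adjoin E' s'}.
Proof. exact: adjoin_min. Qed.

Lemma adjoin_nil (E : divringClosed L) : {subset adjoin E [::] <= E}.
Proof. exact: adjoin_min. Qed.

Lemma adjoin_cat E s1 s2 :
  adjoin E (s1 ++ s2) =i adjoin (adjoin E s1) s2.
Proof.
move=> x; apply/idP/idP; apply: adjoin_sub => y.
- by move=> Ey; do 2!apply: sub_adjoin.
- rewrite mem_cat => /orP[s1y|]; last exact: mem_adjoin.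
  exact/sub_adjoin/mem_adjoin.
- apply: adjoin_sub => z; first exact: sub_adjoin.
  by move=> s1z; apply: mem_adjoin; rewrite mem_cat s1z.
- by move=> s2y; apply: mem_adjoin; rewrite mem_cat s2y orbT.
Qed.

(** Zero denominators do no harm here, as x / 0 = 0. *)
Definition fractions (A : {pred L}) : {pred L} :=
  fun x => `[< exists a b, [/\ a \in A, b \in A & x = a / b] >].

Lemma fractionsP (A : {pred L}) x :
  reflect (exists a b, [/\ a \in A, b \in A & x = a / b]) (x \in fractions A).
Proof. exact: asboolP. Qed.

Section Fractions.

Variable A : subringClosed L.

Lemma sub_fractions : {subset A <= fractions A}.
Proof.
by move=> x Ax; apply/fractionsP; exists x, 1; split; rewrite ?rpred1 ?divr1.
Qed.

Fact fractions_divring_closed : divring_closed (fractions A).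
Proof.
split=> [|x y Fx Fy|x y].
- exact/sub_fractions/rpred1.
- have [->|y0] := eqVneq y 0; first by rewrite subr0.
  have [->|x0] := eqVneq x 0.
    case/fractionsP: Fy => a [b [Aa Ab ->]]; apply/fractionsP.
    by exists (- a), b; split; rewrite ?rpredN // sub0r mulNr.
  case/fractionsP: Fx x0 => a [b [Aa Ab ->]].
  case/fractionsP: Fy y0 => c [d [Ac Ad ->]].
  rewrite !mulf_eq0 !invr_eq0 !negb_or => /andP[_ d0] /andP[_ b0].
  apply/fractionsP; exists (a * d - c * b), (b * d).
  by split; rewrite ?rpredB ?rpredM // -mulNr addf_div // mulNr.
- move=> /fractionsP[a [b [Aa Ab ->]]] /fractionsP[c [d [Ac Ad ->]]].
  apply/fractionsP; exists (a * d), (b * c).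
  by split; rewrite ?rpredM // invf_div mulf_div.
Qed.
HB.instance Definition _ :=
  GRing.isDivringClosed.Build L (fractions A) fractions_divring_closed.

Lemma common_denominator s : {subset s <= fractions A} ->
  exists d, [/\ d \in A, d != 0 & {in s, forall x, d * x \in A}].
Proof.
elim: s => [|x s IHs] sF; first by exists 1; split; rewrite ?rpred1 ?oner_neq0.
have [y sy|d [Ad d0 dA]] := IHs; first by apply: sF; rewrite inE sy orbT.
have /fractionsP[a [b [Aa Ab ->]]] := sF x (mem_head x s).
have [->|b0] := eqVneq b 0.
  exists d; split=> // y; rewrite inE => /predU1P[->|/dA //].
  by rewrite invr0 !mulr0 rpred0.
exists (d * b); split; rewrite ?mulf_neq0 ?rpredM // => y.
rewrite inE => /predU1P[->|/dA dyA]; last by rewrite mulrAC rpredM.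
by rewrite -mulrA [b * _]mulrC divfK // rpredM.
Qed.

Lemma clear_denominators (p : {poly L}) : p \is a polyOver (fractions A) ->
  exists d, [/\ d \in A, d != 0 & d *: p \is a polyOver A].
Proof.
move=> /polyOverP Fp; have [x /(nthP 0)[i _ <-] //|d [Ad d0 dA]] :=
  @common_denominator p.
exists d; split=> //; apply/polyOverP=> i; rewrite coefZ.
have [lti|gei] := ltnP i (size p); first exact/dA/mem_nth.
by rewrite nth_default // mulr0 rpred0.
Qed.

End Fractions.

(** The ring E[b]. *)
Definition poly_values (E : {pred L}) (b : L) : {pred L} :=
  fun x => `[< exists2 q : {poly L}, q \is a polyOver E & x = q.[b] >].

Lemma poly_valuesP E b x :
  reflect (exists2 q : {poly L}, q \is a polyOver E & x = q.[b])
          (x \in poly_values E b).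
Proof. exact: asboolP. Qed.

Section PolyValues.

Variables (E : divringClosed L) (b : L).

Fact poly_values_subring_closed : subring_closed (poly_values E b).
Proof.
split=> [|x y|x y].
- by apply/poly_valuesP; exists 1; rewrite ?rpred1 ?hornerC.
- move=> /poly_valuesP[p Ep ->] /poly_valuesP[q Eq ->]; apply/poly_valuesP.
  by exists (p - q); rewrite ?rpredB ?hornerD ?hornerN.
- move=> /poly_valuesP[p Ep ->] /poly_valuesP[q Eq ->]; apply/poly_valuesP.
  by exists (p * q); rewrite ?rpredM ?hornerM.
Qed.
HB.instance Definition _ := GRing.isSubringClosed.Build L (poly_values E b)
  poly_values_subring_closed.

Lemma adjoin1_fractions :
  {subset adjoin E [:: b] <= fractions (poly_values E b)}.
Proof.
apply: adjoin_min => x.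
  move=> Ex; apply/sub_fractions/poly_valuesP.
  by exists x%:P; rewrite ?polyOverC ?hornerC.
rewrite inE => /eqP->; apply/sub_fractions/poly_valuesP.
by exists 'X; rewrite ?polyOverX ?hornerX.
Qed.

End PolyValues.

(** E(b) = E[b], without asking p to be irreducible: the part of p that is coprime to
    r still has the root b, and its Bezout relation with r inverts r(b). *)
Lemma quotient_eval_small (F : fieldType) (j : {rmorphism F -> L})
    (p q r : {poly F}) b :
    p != 0 -> root (map_poly j p) b ->
  exists h : {poly F}, (size h < size p)%N /\
    (map_poly j q).[b] / (map_poly j r).[b] = (map_poly j h).[b].
Proof.
move=> p0 pb; have [->|rb0] := eqVneq ((map_poly j r).[b]) 0.
  exists 0; rewrite size_poly0 size_poly_gt0 p0.
  by rewrite invr0 mulr0 rmorph0 horner0.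
have gb : root (map_poly j (gdcop r p)) b.
  by rewrite gdcop_map root_gdco ?map_poly_eq0 // pb.
have /Bezout_eq1_coprimepP[[u v] /= uv] := coprimep_gdco r p0.
have vr : (map_poly j v).[b] * (map_poly j r).[b] = 1.
  have := congr1 (fun q => (map_poly j q).[b]) uv.
  rewrite !rmorphD !rmorphM rmorph1 hornerD !hornerM hornerC /=.
  by rewrite (rootP gb) mulr0 add0r.
exists ((q * v) %% p); split; first by rewrite ltn_modp.
have /(congr1 (fun q => (map_poly j q).[b])) := divp_eq (q * v) p.
rewrite rmorphD !rmorphM hornerD !hornerM /= (rootP pb) mulr0 add0r => <-.
by apply: (mulIf rb0); rewrite divfK // -mulrA vr mulr1.
Qed.

Definition algebraic (E : {pred L}) (x : L) :=
  exists p : {poly L}, [/\ p \is a polyOver E, p != 0 & root p x].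

Lemma algebraicS E F x : {subset E <= F} -> algebraic E x -> algebraic F x.
Proof. by move=> EF [p [Ep p0 px]]; exists p; split=> //; apply: polyOverS Ep. Qed.

Lemma algebraic_base (E : divringClosed L) x : x \in E -> algebraic E x.
Proof.
by move=> Ex; exists ('X - x%:P); rewrite polyOverXsubC polyXsubC_eq0 root_XsubC.
Qed.

Section Subfield.

Variable E : divringClosed L.

(** The subfield as a field type, the form in which the theory of algebraic elements
    over the source of a morphism applies to it. *)
Inductive subfield_of := Subfield x & x \in E.
Definition subfield_val u := let: Subfield x _ := u in x.

HB.instance Definition _ := [isSub for subfield_val].
HB.instance Definition _ := [Choice of subfield_of by <:].
HB.instance Definition _ := [SubChoice_isSubUnitRing of subfield_of by <:].
HB.instance Definition _ := [SubNzRing_isSubComNzRing of subfield_of by <:].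
HB.instance Definition _ := [SubComUnitRing_isSubIntegralDomain of subfield_of by <:].
HB.instance Definition _ := [SubIntegralDomain_isSubField of subfield_of by <:].


Lemma polyOver_lift (p : {poly L}) : p \is a polyOver E ->
  exists q : {poly subfield_of}, p = map_poly val q.
Proof.
move=> /polyOverP Ep; exists (\poly_(i < size p) Subfield (Ep i)).
apply/polyP=> i; rewrite coef_map coef_poly.
by case: ltnP => [//|gei]; rewrite nth_default.
Qed.

Lemma algebraicE x :
  algebraic E x <-> algebraicOver (val : subfield_of -> L) x.
Proof.
split=> [[p [/polyOver_lift[q ->] q0 qx]]|[q q0 qx]].
  by exists q; rewrite -?(map_poly_eq0 (val : subfield_of -> L)).
exists (map_poly val q); split=> //; last by rewrite map_poly_eq0.
by apply/polyOverP=> i; rewrite coef_map; case: (q`_i).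
Qed.

Lemma algebraic_overB x y : algebraic E x -> algebraic E y -> algebraic E (x - y).
Proof. by move=> /algebraicE Ex /algebraicE Ey; apply/algebraicE/algebraic_sub. Qed.

Lemma algebraic_over_div x y : algebraic E x -> algebraic E y -> algebraic E (x / y).
Proof. by move=> /algebraicE Ex /algebraicE Ey; apply/algebraicE/algebraic_div. Qed.

Lemma algebraic_root (p : {poly L}) x : p != 0 -> root p x ->
  (forall i, algebraic E p`_i) -> algebraic E x.
Proof.
move=> p0 px Ep; apply/algebraicE/integral_algebraic/(integral_root p0 px) => y.
by move=> /(nthP 0)[i _ <-]; apply/integral_algebraic/algebraicE.
Qed.

Lemma adjoin_algebraic s x : {in s, forall y, algebraic E y} ->
  x \in adjoin E s -> algebraic E x.
Proof.
move=> sE /adjoinP; elim=> {x} [x /algebraic_base //|x /sE //||x y _ Ex _|x y _ Ex _].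
- exact/algebraic_base/rpred1.
- exact: algebraic_overB.
- exact: algebraic_over_div.
Qed.

Lemma algebraic_trans s x : {in s, forall y, algebraic E y} ->
  algebraic (adjoin E s) x -> algebraic E x.
Proof.
move=> sE [p [/polyOverP sp p0 px]]; apply: algebraic_root p0 px _ => i.
exact: adjoin_algebraic (sp i).
Qed.

Lemma simple_extension (p : {poly L}) b x :
    p \is a polyOver E -> p != 0 -> root p b -> x \in adjoin E [:: b] ->
  exists q : {poly L}, [/\ q \is a polyOver E, (size q < size p)%N & x = q.[b]].
Proof.
have valE (q : {poly subfield_of}) : map_poly val q \is a polyOver E.
  by apply/polyOverP=> i; rewrite coef_map; case: (q`_i).
move=> /polyOver_lift[P ->] P0 Pb /adjoin1_fractions/fractionsP[y [z []]].
move: P0; rewrite map_poly_eq0 => P0.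
move=> /poly_valuesP[_ /polyOver_lift[Q ->] ->].
move=> /poly_valuesP[_ /polyOver_lift[R ->] ->] ->.
have [q [sq ->]] := quotient_eval_small Q R P0 Pb.
by exists (map_poly val q); rewrite valE !size_map_poly.
Qed.

End Subfield.

(** A relation between a and b over E can be read in either variable.  Ordered by
    powers of b it remains nontrivial, because its coefficients are polynomials over
    E, not all zero, evaluated at the transcendental element a. *)
Lemma algebraic_exchange (E : divringClosed L) a b :
    algebraic (adjoin E [:: b]) a -> ~ algebraic E a ->
  algebraic (adjoin E [:: a]) b.
Proof.
move=> [p [pEb p0 pa]] naE.
have [|d [_ d0 /polyOverP dpE]] := @clear_denominators (poly_values E b) p.
  exact: polyOverS (@adjoin1_fractions E b) _ pEb.
set P := d *: p in dpE; have P0 : P != 0 by rewrite scaler_eq0 negb_or d0.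
have Pa : root P a by rewrite rootZ.
have [k Ek] : exists k : nat -> {poly L}, forall i,
    k i \is a polyOver E /\ P`_i = (k i).[b].
  suff /choice[k kP] i : exists q : {poly L}, q \is a polyOver E /\ P`_i = q.[b].
    by exists k.
  by have /poly_valuesP[q] := dpE i; exists q.
pose Q := \sum_(i < size P) a ^+ i *: k i.
exists Q; split.
- apply: rpred_sum => i _; apply: polyOverZ.
    by apply/rpredX/mem_adjoin/mem_head.
  exact: polyOverS (@sub_adjoin E [:: a]) _ (Ek i).1.
- apply/eqP=> Q0; case/eqP: P0; apply/polyP=> i; rewrite coef0.
  have [lti|/(nth_default 0) //] := ltnP i (size P).
  rewrite (Ek i).2; suff -> : k i = 0 by rewrite horner0.
  apply/polyP=> j; rewrite coef0; apply/eqP/negPn/negP=> kij; apply: naE.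
  exists (\poly_(l < size P) (k l)`_j); split.
  + by apply/polyOverP=> l; rewrite coef_poly; case: ifP=> _;
      rewrite ?rpred0 // (polyOverP (Ek l).1).
  + by apply: contraNneq kij => /polyP/(_ i); rewrite coef_poly lti coef0 => ->.
  apply/rootP; rewrite horner_poly; move/polyP/(_ j): Q0; rewrite coef0 coef_sum.
  by move=> Qj0; rewrite -[RHS]Qj0; apply: eq_bigr => l _; rewrite coefZ mulrC.
- apply/rootP; rewrite -[RHS](rootP Pa) [RHS]horner_coef /Q horner_sum.
  by apply: eq_bigr => i _; rewrite hornerZ (Ek i).2 mulrC.
Qed.

(** Independence in successive form.  The base field varies, which is what lets the
    induction in [chain_size] absorb one element after the other. *)
Fixpoint chain (E : {pred L}) s : Prop :=
  if s is x :: s' then ~ algebraic E x /\ chain (adjoin E [:: x]) s' else True.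

Lemma chain_intro (E : divringClosed L) s :
    (forall s1 x s2, s = s1 ++ x :: s2 -> ~ algebraic (adjoin E s1) x) ->
  chain E s.
Proof.
elim: s E => //= x s IHs E free; split.
  move=> Ex; apply: (free [::] x s erefl).
  exact: algebraicS (@sub_adjoin E [::]) Ex.
apply: IHs => s1 y s2 s_eq algy; apply: (free (x :: s1) y s2); first by rewrite s_eq.
by apply: algebraicS algy => z; rewrite (adjoin_cat E [:: x] s1).
Qed.

(** The element to be exchanged for a is the first one of t that makes a algebraic. *)
Lemma algebraic_replace (E : divringClosed L) t a :
    ~ algebraic E a -> algebraic (adjoin E t) a ->
  exists t', size t = (size t').+1 /\
    {in t, forall y, algebraic (adjoin (adjoin E [:: a]) t') y}.
Proof.
elim: t E => [|b t IHt] E naE; first by move/(algebraicS (@adjoin_nil E)).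
move=> algEt; have [Eb|nEb] := pselect (algebraic (adjoin E [:: b]) a).
  exists t; split=> // y; rewrite inE => /predU1P[->|ty].
    by apply: algebraicS (algebraic_exchange Eb naE); apply: sub_adjoin.
  exact/algebraic_base/mem_adjoin.
have [|t' [st tt']] := IHt _ nEb.
  by apply: algebraicS algEt => z; rewrite (adjoin_cat E [:: b] t).
exists (b :: t'); split=> [|y]; first by rewrite /= st.
rewrite inE => /predU1P[->|/tt']; first exact/algebraic_base/mem_adjoin/mem_head.
apply: algebraicS => z.
rewrite -(adjoin_cat E [:: a]) -(adjoin_cat _ [:: a]) -(adjoin_cat E [:: b]) => zE.
apply: adjoin_sub zE => w; first exact: sub_adjoin.
by move=> tw; apply: mem_adjoin; move: tw; rewrite !inE orbCA.
Qed.

(** Steinitz: each element of the chain takes the place of one element of t. *)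
Lemma chain_size (E : divringClosed L) s t :
    chain E s -> {in s, forall x, algebraic (adjoin E t) x} ->
  (size s <= size t)%N.
Proof.
elim: s E t => //= a s IHs E t [naE chs] st.
have [|t' [-> tt']] := algebraic_replace naE (st a _); first exact: mem_head.
rewrite ltnS; apply: IHs chs _ => x sx.
apply: algebraic_trans tt' _; have: algebraic (adjoin E t) x.
  by apply: st; rewrite inE sx orbT.
apply: algebraicS; apply: adjoin_sub => y; last exact: mem_adjoin.
by move=> Ey; do 3!apply: sub_adjoin.
Qed.

(** An element depending on the others could be dropped, leaving a spanning family
    shorter than a chain. *)
Lemma spanning_free (E : divringClosed L) s t1 x t2 :
    chain E s -> {in s, forall y, algebraic (adjoin E (t1 ++ x :: t2)) y} ->
    (size (t1 ++ x :: t2) <= size s)%N ->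
  ~ algebraic (adjoin E (t1 ++ t2)) x.
Proof.
move=> chs st le_ts algx.
suff: (size s <= size (t1 ++ t2))%N.
  by move/(leq_trans le_ts); rewrite !size_cat /= addnS ltnn.
apply: chain_size chs _ => y /st algy; apply: (@algebraic_trans _ [:: x]).
  by move=> z; rewrite inE => /eqP->.
apply: algebraicS algy => z; rewrite -adjoin_cat; apply: adjoin_sub => w.
  exact: sub_adjoin.
by move=> tw; apply: mem_adjoin; move: tw; rewrite !mem_cat !inE orbA orbAC.
Qed.

(** Write f = q(b) with q over E of degree at most m.  As sigma fixes f and the
    coefficients of q, the polynomial q - f vanishes at the m + 1 conjugates of b, so
    it is zero and f is the constant coefficient of q. *)
Lemma fixed_descent (E : divringClosed L) (sigma : {rmorphism L -> L}) m b f :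
    {in E, forall c, sigma c = c} -> uniq (traject sigma b m.+1) ->
    \prod_(y <- traject sigma b m.+1) ('X - y%:P) \is a polyOver E ->
    f \in adjoin E [:: b] -> sigma f = f ->
  f \in E.
Proof.
move=> sigmaE Ub minb fEb sf.
have [||q [Eq sq fq]] := simple_extension minb _ _ fEb.
- exact/monic_neq0/monic_prod_XsubC.
- by rewrite root_prod_XsubC mem_head.
have fix_q : map_poly sigma q = q.
  by apply/polyP=> i; rewrite coef_map /= sigmaE // (polyOverP Eq).
have [/eqP qf0|qf0] := eqVneq (q - f%:P) 0.
  move: qf0; rewrite subr_eq0 => /eqP qf.
  by move/polyOverP/(_ 0%N): Eq; rewrite qf coefC.
have roots : all (root (q - f%:P)) (traject sigma b m.+1).
  apply/allP=> _ /trajectP[i _ ->]; rewrite rootE hornerD hornerN hornerC.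
  suff -> : q.[iter i sigma b] = f by rewrite subrr.
  elim: i => // i IHi; rewrite iterS -{1}fix_q horner_map /= IHi //.
have := max_poly_roots qf0 roots Ub; rewrite size_traject ltnNge => /negP[].
rewrite (leq_trans (size_polyD _ _)) // geq_max size_polyN size_polyC.
move: sq; rewrite size_prod_XsubC size_traject ltnS => ->.
by case: eqP.
Qed.

End Adjunction.

(** * Transcendence bases *)

Lemma mmap_muni (R : comNzRingType) (S : comNzRingType) (f : {rmorphism R -> S})
    n (t : 'I_n.+1 -> S) (p : {mpoly R[n.+1]}) :
  mmap f t p =
  (map_poly (mmap f (t \o widen_ord (leqnSn n))) (muni p)).[t ord_max].
Proof.
rewrite muniE rmorph_sum horner_sum /=; apply: eq_bigr => m _.
rewrite map_polyZ map_polyXn hornerZ hornerXn /= mmapZ mmapX.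
rewrite -mulrA; congr (_ * _).
rewrite /mmap1 big_ord_recr /=; congr (_ * _).
by apply: eq_bigr => i _; rewrite mnmE.
Qed.

Lemma muni_eq0 (R : comNzRingType) n (p : {mpoly R[n.+1]}) : muni p = 0 -> p = 0.
Proof.
move=> p0; rewrite -[p]comp_mpoly_id /comp_mpoly mmap_muni p0.
by rewrite rmorph0 horner0.
Qed.

Section Constants.

Variables (K L : fieldType) (iota : {rmorphism K -> L}).

Definition constants : {pred L} := fun x => `[< exists c, x = iota c >].

Lemma constantsP x : reflect (exists c, x = iota c) (x \in constants).
Proof. exact: asboolP. Qed.

Lemma mem_constants c : iota c \in constants.
Proof. by apply/constantsP; exists c. Qed.

Fact constants_divring_closed : divring_closed constants.
Proof.
split=> [|_ _ /constantsP[c ->] /constantsP[d ->]|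
          _ _ /constantsP[c ->] /constantsP[d ->]]; apply/constantsP.
- by exists 1; rewrite rmorph1.
- by exists (c - d); rewrite rmorphB.
- by exists (c / d); rewrite fmorph_div.
Qed.
HB.instance Definition _ :=
  GRing.isDivringClosed.Build L constants constants_divring_closed.

Lemma adjoin_generated n (t : 'I_n -> L) x :
  x \in adjoin constants (codom t) <-> generated_field iota t x.
Proof.
split=> [/adjoinP|].
  elim=> {x} [_ /constantsP[c ->]|x /codomP[i ->]||x y _ Ex _ Ey|x y _ Ex _ Ey].
  - exact: generated_const.
  - exact: generated_var.
  - by rewrite -(rmorph1 iota); apply: generated_const.
  - exact: generated_sub.
  - exact: generated_div.
elim=> [c|i|f g _ Ef _ Eg|f g _ Ef _ Eg].
- exact/sub_adjoin/mem_constants.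
- exact/mem_adjoin/codom_f.
- exact: rpredB.
- exact: rpred_div.
Qed.

Lemma mmap_adjoin (E : divringClosed L) n (t : 'I_n -> L) p :
  {subset constants <= E} -> (forall i, t i \in E) -> mmap iota t p \in E.
Proof.
move=> kE tE; apply: rpred_sum => m _; apply: rpredM; first exact/kE/mem_constants.
by apply: rpred_prod => i _; apply: rpredX.
Qed.

(** Read the relation as a polynomial in the last variable.  Either it stays
    nontrivial at the other elements, or one of its coefficients is a nontrivial
    relation between these, and induction applies. *)
Lemma algebraic_of_relation n (t : 'I_n -> L) (p : {mpoly K[n]}) :
    p != 0 -> mmap iota t p = 0 ->
  exists i, algebraic (adjoin constants [seq t j | j <- enum 'I_n & j != i]) (t i).
Proof.
elim: n t p => [|n IHn] t p p0 pt0.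
  have pC : p = (p@_0%MM)%:MP.
    apply/mpolyP=> m; rewrite mcoeffC; have -> : m = 0%MM by apply/mnmP=> -[].
    by rewrite eqxx mulr1.
  move: p0 pt0; rewrite {}pC mmapC mpolyC_eq0 => p0 /eqP.
  by rewrite fmorph_eq0 (negPf p0).
pose w := widen_ord (leqnSn n); pose phi := mmap iota (t \o w).
have w_max (i : 'I_n) : w i != ord_max by rewrite -val_eqE /= ltn_eqF.
have [q0|q0] := eqVneq (map_poly phi (muni p)) 0; last first.
  exists ord_max, (map_poly phi (muni p)); split=> //; last first.
    by apply/rootP; rewrite -mmap_muni.
  apply/polyOverP=> k; rewrite coef_map; apply: mmap_adjoin => [|i /=].
    exact: sub_adjoin.
  by apply: mem_adjoin; rewrite map_f // mem_filter w_max mem_enum.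
have [k pk0] : exists k, (muni p)`_k != 0.
  apply: contrapT => pk0; case/eqP: p0; apply: muni_eq0; apply/polyP=> k.
  by rewrite coef0; apply/eqP/negPn/negP=> pk; apply: pk0; exists k.
have [|i algi] := IHn (t \o w) _ pk0.
  by have /polyP/(_ k) := q0; rewrite coef_map coef0.
exists (w i); apply: algebraicS algi; apply: adjoin_sub; first exact: sub_adjoin.
move=> y /mapP[j]; rewrite mem_filter => /andP[ji _] -> /=; apply: mem_adjoin.
apply/mapP; exists (w j); rewrite // mem_filter mem_enum andbT.
by apply: contraNneq ji => /(congr1 val) /= ?; apply/eqP/val_inj.
Qed.

(** A relation would make one of the t i algebraic over the others, against
    [spanning_free]. *)
Lemma spanning_independent n (t : 'I_n -> L) s :
    chain constants s -> size s = n ->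
    {in s, forall x, algebraic (adjoin constants (codom t)) x} ->
  algebraically_independent iota t.
Proof.
move=> chs sn st p pt0; apply/eqP/negPn/negP=> p0.
have [i algi] := algebraic_of_relation p0 pt0.
have mem_i : i \in enum 'I_n by rewrite mem_enum.
have [e1 [e2 def_e]] : exists e1 e2, enum 'I_n = e1 ++ i :: e2.
  by case/splitPr: mem_i => e1 e2; exists e1, e2.
have def_t : codom t = map t e1 ++ t i :: map t e2.
  by rewrite codomE def_e map_cat.
have := @spanning_free _ constants s (map t e1) (t i) (map t e2) chs.
rewrite -def_t size_codom card_ord sn => /(_ st (leqnn n)); apply.
apply: algebraicS algi; apply: adjoin_sub; first exact: sub_adjoin.
move=> y /mapP[j]; rewrite mem_filter def_e mem_cat inE => /andP[ji].
rewrite (negPf ji) /= => je ->; apply: mem_adjoin.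
by rewrite mem_cat; case/orP: je => /(map_f t)->; rewrite ?orbT.
Qed.

End Constants.

(** * Fixed fields of permutation groups *)

Lemma mpolyX_inj (R : nzRingType) n :
  injective (fun m : 'X_{1..n} => 'X_[m] : {mpoly R[n]}).
Proof.
move=> m1 m2 /mpolyP/(_ m1)/eqP; rewrite !mcoeffX eqxx.
by have [->|_] := eqVneq m2 m1; rewrite ?oner_eq0.
Qed.

Section RationalFunctions.

Variables (K : fieldType) (n : nat).
Local Notation L := (ratfun K n).
Local Notation k := (constants (ratC K n)).
Implicit Types (f g : L) (p q : {mpoly K[n]}) (s t : 'S_n).

Definition ratX (i : 'I_n) : L := ('X_i)%:F.

Lemma ratX_inj : injective ratX.
Proof. by move=> i j /eqP; rewrite tofrac_eq => /eqP/mpolyX_inj/eqP; rewrite eq_mnm1 => /eqP. Qed.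

Lemma tofrac_mmap p : p%:F = mmap (ratC K n) ratX p.
Proof.
rewrite [p in LHS]mpolyE rmorph_sum; apply: eq_bigr => m _ /=.
rewrite -mul_mpolyC rmorphM; congr (_ * _).
rewrite /mmap1 mpolyXE_id rmorph_prod; apply: eq_bigr => i _ /=.
by rewrite rmorphXn.
Qed.

Lemma ratfun_generated f : f \in adjoin k (codom ratX).
Proof.
rewrite [f]ratfun_reprE !tofrac_mmap; apply: rpred_div;
  by apply: mmap_adjoin => [|i]; [apply: sub_adjoin | apply/mem_adjoin/codom_f].
Qed.

Definition power_sub i m : n.-tuple {mpoly K[n]} :=
  [tuple if j == i then 'X_i ^+ m else 'X_j | j < n].

(** The polynomials in which X_i does not occur, described as those invariant under
    all substitutions X_i := X_i^m; this is visibly a ring. *)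
Definition without_var i : {pred L} := fun f =>
  `[< exists p, f = p%:F /\ forall m, p \mPo power_sub i m = p >].

Lemma without_varP i f :
  reflect (exists p, f = p%:F /\ forall m, p \mPo power_sub i m = p)
          (f \in without_var i).
Proof. exact: asboolP. Qed.

Fact without_var_subring_closed i : subring_closed (without_var i).
Proof.
split=> [|_ _ /without_varP[p [-> pi]] /without_varP[q [-> qi]]|
          _ _ /without_varP[p [-> pi]] /without_varP[q [-> qi]]];
  apply/without_varP.
- by exists 1; rewrite tofrac1; split=> // m; apply: comp_mpoly1.
- by exists (p - q); rewrite rmorphB; split=> // m; rewrite comp_mpolyB pi qi.
- by exists (p * q); rewrite rmorphM; split=> // m; rewrite rmorphM /= pi qi.
Qed.
HB.instance Definition _ i := GRing.isSubringClosed.Build L (without_var i)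
  (without_var_subring_closed i).

(** If X_i is a root of a polynomial whose coefficients do not involve X_i, then so are
    all its powers, and there are too many of them. *)
Lemma transcendental_var i :
  ~ algebraic (adjoin k [seq ratX j | j <- enum 'I_n & j != i]) (ratX i).
Proof.
move=> [P [kP P0 Pi]]; have subF : {subset adjoin k
    [seq ratX j | j <- enum 'I_n & j != i] <= fractions (without_var i)}.
  apply: adjoin_min => [_ /constantsP[c ->]|y /mapP[j]].
    apply/sub_fractions/without_varP; exists c%:MP; split=> // m.
    exact: comp_mpolyC.
  rewrite mem_filter => /andP[/negPf ji _] ->; apply/sub_fractions/without_varP.
  exists 'X_j; split=> // m.
  by rewrite comp_mpolyXU -tnth_nth tnth_mktuple ji.
have [|d [_ d0 /polyOverP dP]] := @clear_denominators _ (without_var i) P.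
  exact: polyOverS subF _ kP.
have [c cP] : exists c : nat -> {mpoly K[n]}, forall j,
    (d *: P)`_j = (c j)%:F /\ forall m, c j \mPo power_sub i m = c j.
  suff /choice[c cP] j : exists p,
      (d *: P)`_j = p%:F /\ forall m, p \mPo power_sub i m = p by exists c.
  exact/without_varP/dP.
pose Q := \poly_(j < size P) c j.
have QP : map_poly (@FracField.tofrac {mpoly K[n]}) Q = d *: P.
  apply/polyP=> j; rewrite coef_map coef_poly; case: ltnP => [_|gej].
    by rewrite (cP j).1.
  by rewrite /= tofrac0 coefZ nth_default ?mulr0.
have Q0 : Q != 0.
  apply: contraNneq P0 => Q0; move: QP; rewrite Q0 rmorph0 => /esym/eqP.
  by rewrite scaler_eq0 (negPf d0).
have Qi : Q.['X_i] = 0.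
  apply/eqP; rewrite -tofrac_eq0 -horner_map /= QP.
  by apply/eqP; rewrite hornerZ (rootP Pi); apply: mulr0.
pose r := [seq 'X_i ^+ m : {mpoly K[n]} | m <- iota 0 (size Q)].
have Ur : uniq r.
  rewrite map_inj_uniq ?iota_uniq // => a b; rewrite !mpolyXn => /mpolyX_inj.
  move/mnmP/(_ i); rewrite !mulmnE mnm1E eqxx.
  by rewrite !mul1n.
have rQ : all (root Q) r.
  apply/allP=> _ /mapP[m _ ->]; apply/rootP.
  move/(congr1 (fun p => p \mPo power_sub i m)): Qi; rewrite comp_mpoly0 => <-.
  rewrite !horner_poly rmorph_sum; apply: eq_bigr => j _ /=.
  rewrite rmorphM rmorphXn /= (cP j).2 comp_mpolyXU -tnth_nth tnth_mktuple.
  by rewrite eqxx.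
by have := max_poly_roots Q0 rQ Ur; rewrite size_map size_iota ltnn.
Qed.

Lemma chain_vars : chain k (codom ratX).
Proof.
apply: chain_intro => s1 x s2 def_s.
have Us : uniq (codom ratX).
  by rewrite codomE map_inj_uniq ?enum_uniq //; apply: ratX_inj.
have /codomP[i def_x] : x \in codom ratX.
  by rewrite def_s mem_cat mem_head orbT.
subst x; move=> alg; apply: (@transcendental_var i); apply: algebraicS alg.
apply: adjoin_sub => y; first exact: sub_adjoin.
move=> s1y; have /codomP[j def_y] : y \in codom ratX.
  by rewrite def_s mem_cat s1y.
apply: mem_adjoin; apply/mapP; exists j; rewrite // mem_filter mem_enum andbT.
apply: contraTneq s1y => ji; rewrite def_y ji.
by move: Us; rewrite def_s cat_uniq => /and3P[_ /norP[]].
Qed.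

Lemma ratpermM s t f : ratperm (s * t)%g f = ratperm t (ratperm s f).
Proof.
have [p [q [q0 ->]]] : exists p q, q != 0 /\ f = p%:F / q%:F.
  by do 2!eexists; split; [apply: denom_ratioP | apply: ratfun_reprE].
rewrite (ratperm_fracE s p q0) (ratperm_fracE t) ?msym_eq0 //.
by rewrite (ratperm_fracE (s * t)%g p q0); congr (_%:F / _%:F); apply: msymMm.
Qed.


Lemma ratperm1 f : ratperm 1 f = f.
Proof.
by rewrite /ratperm !msym1m -ratfun_reprE.
Qed.

Lemma fixedP (G : {set 'S_n}) f :
  reflect {in G, forall s, ratperm s f = f} (f \in fixed_ratfun K G).
Proof. by apply: (iffP 'forall_in_eqP). Qed.


Fact fixed_divring_closed (G : {set 'S_n}) : divring_closed (fixed_ratfun K G).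
Proof.
split=> [|f g /fixedP fG /fixedP gG|f g /fixedP fG /fixedP gG];
  apply/fixedP=> s Gs.
- by rewrite rmorph1.
- by rewrite rmorphB /= fG ?gG.
- by rewrite fmorph_div /= fG ?gG.
Qed.
HB.instance Definition _ (G : {set 'S_n}) :=
  GRing.isDivringClosed.Build L (fixed_ratfun K G) (fixed_divring_closed G).

Lemma constants_fixed (G : {set 'S_n}) : {subset k <= fixed_ratfun K G}.
Proof. by move=> _ /constantsP[c ->]; apply/fixedP=> s _; apply: ratpermC. Qed.

(** f is a root of the product of the X - s(f), for s in G. *)
Lemma algebraic_fixed (G : {group 'S_n}) f : algebraic (fixed_ratfun K G) f.
Proof.
pose P := \prod_(s in G) ('X - (ratperm s f)%:P).
exists P; split; last 2 first.
- exact/monic_neq0/monic_prod_XsubC.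
- rewrite /P (bigD1 1%g) //= rootM root_XsubC.
  by rewrite ratperm1 eqxx.
suff PG s : s \in G -> map_poly (ratperm s) P = P.
  apply/polyOverP=> i; apply/fixedP=> s /PG/polyP/(_ i).
  by rewrite coef_map.
move=> Gs; rewrite rmorph_prod [RHS](reindex_inj (mulIg s)) /=.
apply: eq_big => [t|t Gt]; first by rewrite groupMr.
by rewrite map_polyXsubC ratpermM.
Qed.

Definition generates (G : {set 'S_n}) (s : seq L) :=
  fixed_ratfun K G =i adjoin k s.

(** The variables form a chain and are algebraic over the fixed field, so [n]
    generators of it are algebraically independent. *)
Theorem rational_of_generators (G : {group 'S_n}) (s : seq L) :
  size s = n -> generates G s -> rational_over (ratC K n) (fixed_ratfun K G).
Proof.
move=> sn gen; pose t (i : 'I_n) := nth 0 s i.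
have def_t : codom t = s.
  apply: (@eq_from_nth _ 0); rewrite size_codom card_ord // => i ltin.
  rewrite (nth_map (Ordinal ltin)) ?size_enum_ord // /t.
  by rewrite nth_enum_ord.
exists n, t; split; last by move=> f; rewrite gen -def_t adjoin_generated.
apply: spanning_independent chain_vars _ _; first by rewrite size_codom card_ord.
move=> x _; apply: algebraicS (algebraic_fixed G x) => f.
by rewrite gen def_t.
Qed.

Lemma generates_conj (G : {group 'S_n}) (s : seq L) (r : 'S_n) :
  generates (G :^ r)%G s -> generates G (map (ratperm r^-1%g) s).
Proof.
have ratK (h : 'S_n) f : ratperm h^-1%g (ratperm h f) = f.
  by rewrite -ratpermM mulgV ratperm1.
have map_adjoin (h : 'S_n) (s' : seq L) f : f \in adjoin k s' ->
    ratperm h f \in adjoin k (map (ratperm h) s').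
  move/adjoinP; elim=> {f} [_ /constantsP[c ->]|x sx||x y _ Ex _ Ey|x y _ Ex _ Ey].
  - by rewrite ratpermC; apply/sub_adjoin/mem_constants.
  - exact/mem_adjoin/map_f.
  - by rewrite rmorph1 rpred1.
  - by rewrite rmorphB rpredB.
  - by rewrite fmorph_div rpred_div.
move=> gen f; transitivity (ratperm r f \in fixed_ratfun K (G :^ r)%G).
  apply/fixedP/fixedP=> fG h Gh.
    have /imsetP[h' Gh' ->] := Gh.
    by rewrite -ratpermM conjgE !mulgA mulgV mul1g ratpermM fG.
  have fGh : ratperm (h ^ r)%g (ratperm r f) = ratperm r f.
    by apply: fG; rewrite memJ_conjg.
  rewrite -{2}(ratK r f) -fGh -!ratpermM; congr (ratperm _ f).
  by rewrite conjgE !mulgA mulgV mul1g mulgK.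
rewrite gen; apply/idP/idP => [/(map_adjoin r^-1%g)|/(map_adjoin r)].
  by rewrite ratK.
by rewrite -map_comp map_id_in // => x _ /=; rewrite -{1}[r]invgK ratK.
Qed.

(** It is enough to test invariance on generators of the group. *)
Lemma generates_gen (A : seq 'S_n) (s : seq L) :
    {in A, forall h, all (fun x => ratperm h x == x) s} ->
    (forall f, {in A, forall h, ratperm h f = f} -> f \in adjoin k s) ->
  generates <<[set x in A]>>%g s.
Proof.
move=> sA genA f; apply/fixedP/idP=> [fA|].
  by apply: genA => h Ah; apply: fA; rewrite mem_gen // inE.
move=> fs h0; pose H := [set h : 'S_n | ratperm h f == f].
have H_group : group_set H.
  apply/group_setP; split=> [|h1 h2]; first by rewrite in_set ratperm1.
  by rewrite !in_set => /eqP fh1 /eqP fh2; rewrite ratpermM fh1 fh2.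
have: <<[set x in A]>>%g \subset Group H_group.
  rewrite gen_subG; apply/subsetP=> h; rewrite !in_set => Ah.
  suff /fixedP/(_ h (set11 h))-> : f \in fixed_ratfun K [set h] by [].
  apply: (adjoin_min _ _ fs); first exact: constants_fixed.
  move=> x sx; apply/fixedP=> h' /set1P->.
  exact/eqP/(allP (sA h Ah)).
by move/subsetP/(_ h0) => sub /sub; rewrite in_set => /eqP.
Qed.

(** Multiply both terms of the fraction by the other conjugates of the denominator. *)
Lemma fixed_fraction (G : {group 'S_n}) f : f \in fixed_ratfun K G ->
  exists p q, [/\ f = p%:F / q%:F, {in G, forall s, msym s p = p} &
                  {in G, forall s, msym s q = q}].
Proof.
move=> /fixedP fG; pose q := \prod_(s in G) msym s \d_(generic_quotient.repr f).
have qG : {in G, forall s, msym s q = q}.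
  move=> s Gs; rewrite rmorph_prod [RHS](reindex_inj (mulIg s)) /=.
  apply: eq_big => [t|t Gt]; first by rewrite groupMr.
  by rewrite msymMm.
have q0 : q != 0.
  by apply/prodf_neq0=> s _; rewrite msym_eq0 denom_ratioP.
have [p fq] : exists p, f * q%:F = p%:F.
  rewrite /q (bigD1 1%g) //= msym1m rmorphM /= mulrA {1}[f]ratfun_reprE.
  by rewrite divfK ?tofrac_eq0 ?denom_ratioP // -rmorphM; eexists.
exists p, q; split=> //; first by rewrite -fq mulfK // tofrac_eq0.
move=> s Gs; apply/eqP; rewrite -tofrac_eq -ratperm_tofrac -fq rmorphM /=.
by rewrite ratperm_tofrac qG // fG.
Qed.

Theorem symmetric_generates :
  generates [set: 'S_n] (codom (fun i : 'I_n => ((mesym n K i.+1))%:F)).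
Proof.
move=> f; apply/idP/idP => [/fixed_fraction[p [q [-> pS qS]]]|]; last first.
  apply: adjoin_min f; first exact: constants_fixed.
  move=> _ /codomP[i ->]; apply/fixedP=> s _.
  by rewrite ratperm_tofrac; have /issymP-> := mesym_sym n K i.+1.
have symE (r : {mpoly K[n]}) : {in [set: 'S_n], forall s, msym s r = r} ->
    r%:F \in adjoin k (codom (fun i : 'I_n => ((mesym n K i.+1))%:F : L)).
  move=> rS; have [|u [<- _]] := @sym_fundamental n K r.
    by apply/issymP=> s; apply: rS; rewrite inE.
  rewrite comp_mpolyEX rmorph_sum; apply: rpred_sum => m _ /=.
  rewrite -mul_mpolyC rmorphM /=; apply: rpredM.
    by apply/sub_adjoin/constantsP; exists u@_m.
  rewrite comp_mpolyX rmorph_prod; apply: rpred_prod => i _ /=.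
  rewrite rmorphXn; apply/rpredX/mem_adjoin/codomP.
  by exists i; rewrite tnth_mktuple.
by apply: rpred_div; apply: symE.
Qed.

End RationalFunctions.

Local Open Scope group_scope.

(** * Groups containing the three-cycles *)

Definition cyc3 (T : finType) (i j k : T) : {perm T} := tperm i j * tperm i k.

Lemma cyc3J (T : finType) (i j k : T) s :
  cyc3 i j k ^ s = cyc3 (s i) (s j) (s k).
Proof. by rewrite /cyc3 conjMg !tpermJ. Qed.

(** An even permutation is a product of pairs of transpositions.  Two transpositions
    with a common point make a three-cycle, and two disjoint ones make the product of
    two three-cycles, through a transposition meeting both. *)
Lemma Alt_sub_cyc3 (T : finType) (G : {group {perm T}}) :
    (forall i j k, uniq [:: i; j; k] -> cyc3 i j k \in G) ->
  'Alt_T \subset G.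
Proof.
move=> cycG.
have share a b c : a != b -> a != c -> tperm a b * tperm a c \in G.
  move=> ab ac; have [->|bc] := eqVneq b c; first by rewrite tperm2 group1.
  by apply: cycG; rewrite /= !inE negb_or ab ac bc.
have pairG a b c d : a != b -> c != d -> tperm a b * tperm c d \in G.
  move=> ab cd; have [eq_ca|ac] := eqVneq c a.
    by subst c; apply: share.
  have -> : tperm a b * tperm c d = (tperm a b * tperm a c) * (tperm c a * tperm c d).
    by rewrite (tpermC c a) -mulgA; congr (_ * _); rewrite mulgA tperm2 mul1g.
  by rewrite groupM ?share // eq_sym.
apply/subsetP=> s; rewrite Alt_even; have [ts -> dts] := prod_tpermP s.
rewrite odd_perm_prod //; have [m] := ubnP (size ts).
elim: m ts dts => // m IHm [|[a b] [|[c d] ts]] //=; first by rewrite big_nil group1.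
case/and3P=> ab cd dts sm; rewrite negbK => ts_even.
by rewrite !big_cons mulgA groupM ?pairG //= IHm // -ltnS ltnW.
Qed.

Lemma Alt_or_Sym (T : finType) (G : {group {perm T}}) :
  'Alt_T \subset G -> G :=: 'Alt_T \/ G :=: [set: {perm T}].
Proof.
move=> sAG; have [/subsetP sGA|] := boolP (G \subset 'Alt_T).
  by left; apply/eqP; rewrite eqEsubset sAG andbT; apply/subsetP.
case/subsetPn=> g Gg; rewrite Alt_even negbK => odd_g; right.
apply/setP=> s; rewrite inE.
have [|] := boolP (odd_perm s) => s_odd; last first.
  by apply: (subsetP sAG); rewrite Alt_even.
by rewrite -(groupMr s Gg); apply: (subsetP sAG); rewrite Alt_even odd_permM s_odd odd_g.
Qed.

(** * Permutations of six points preserving two blocks *)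

Notation "''o_' i" := (@Ordinal 6 i isT) (at level 8, i at level 2, format "''o_' i").

(** Locked, as unification would otherwise unfold these permutations; they are only
    used through their codes. *)
HB.lock Definition rot1 : 'S_6 := tperm 'o_0 'o_1 * tperm 'o_0 'o_2.
HB.lock Definition rot2 : 'S_6 := tperm 'o_3 'o_4 * tperm 'o_3 'o_5.
HB.lock Definition flip1 : 'S_6 := tperm 'o_0 'o_1.
HB.lock Definition flip2 : 'S_6 := tperm 'o_3 'o_4.
HB.lock Definition swap : 'S_6 := tperm 'o_0 'o_3 * tperm 'o_1 'o_4 * tperm 'o_2 'o_5.

Definition points : seq 'I_6 := [:: 'o_0; 'o_1; 'o_2; 'o_3; 'o_4; 'o_5].

Lemma mem_points i : i \in points.
Proof. by case: i => [[|[|[|[|[|[|i]]]]]] ?]; rewrite !inE -!val_eqE. Qed.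

(** The list of values of g, on which products of concrete permutations compute. *)
Definition code (g : 'S_6) : seq nat := [seq val (g i) | i <- points].
Definition mulc (l m : seq nat) := [seq nth 0%N m i | i <- l].

Arguments code : simpl never.

Lemma nth_code g (i : 'I_6) : nth 0%N (code g) i = g i.
Proof.
rewrite (nth_map 'o_0) //; congr (val (g _)).
by case: i => [[|[|[|[|[|[|i]]]]]] ?] //=; apply: val_inj.
Qed.

Lemma code_inj : injective code.
Proof.
by move=> g h gh; apply/permP=> i; apply: val_inj; rewrite /= -!nth_code gh.
Qed.

Lemma codeM g h : code (g * h) = mulc (code g) (code h).
Proof.
rewrite /mulc -map_comp; apply: eq_map => i /=.
by rewrite nth_code permM.
Qed.

Lemma code1 : code 1 = iota 0%N 6.
Proof. by rewrite /code /= !perm1. Qed.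

Lemma code_rot1 : code rot1 = [:: 1; 2; 0; 3; 4; 5]%N.
Proof. by rewrite rot1.unlock /code /= !permM !permE. Qed.
Lemma code_rot2 : code rot2 = [:: 0; 1; 2; 4; 5; 3]%N.
Proof. by rewrite rot2.unlock /code /= !permM !permE. Qed.
Lemma code_flip1 : code flip1 = [:: 1; 0; 2; 3; 4; 5]%N.
Proof. by rewrite flip1.unlock /code /= !permE. Qed.
Lemma code_flip2 : code flip2 = [:: 0; 1; 2; 4; 3; 5]%N.
Proof. by rewrite flip2.unlock /code /= !permE. Qed.
Lemma code_swap : code swap = [:: 3; 4; 5; 0; 1; 2]%N.
Proof. by rewrite swap.unlock /code /= !permM !permE. Qed.

Definition codeE := (codeM, code1, code_rot1, code_rot2, code_flip1, code_flip2, code_swap).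

Lemma code_at g (i j : 'I_6) : nth 0%N (code g) i == j -> g i = j.
Proof. by rewrite nth_code => /eqP/val_inj. Qed.

Lemma rot1_at :
  (rot1 'o_0 = 'o_1) * (rot1 'o_1 = 'o_2) * (rot1 'o_2 = 'o_0) *
  (rot1 'o_3 = 'o_3) * (rot1 'o_4 = 'o_4) * (rot1 'o_5 = 'o_5).
Proof. by do !split; apply: code_at; rewrite code_rot1. Qed.
Lemma rot2_at :
  (rot2 'o_0 = 'o_0) * (rot2 'o_1 = 'o_1) * (rot2 'o_2 = 'o_2) *
  (rot2 'o_3 = 'o_4) * (rot2 'o_4 = 'o_5) * (rot2 'o_5 = 'o_3).
Proof. by do !split; apply: code_at; rewrite code_rot2. Qed.
Lemma flip1_at :
  (flip1 'o_0 = 'o_1) * (flip1 'o_1 = 'o_0) * (flip1 'o_2 = 'o_2) *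
  (flip1 'o_3 = 'o_3) * (flip1 'o_4 = 'o_4) * (flip1 'o_5 = 'o_5).
Proof. by do !split; apply: code_at; rewrite code_flip1. Qed.
Lemma flip2_at :
  (flip2 'o_0 = 'o_0) * (flip2 'o_1 = 'o_1) * (flip2 'o_2 = 'o_2) *
  (flip2 'o_3 = 'o_4) * (flip2 'o_4 = 'o_3) * (flip2 'o_5 = 'o_5).
Proof. by do !split; apply: code_at; rewrite code_flip2. Qed.
Lemma swap_at :
  (swap 'o_0 = 'o_3) * (swap 'o_1 = 'o_4) * (swap 'o_2 = 'o_5) *
  (swap 'o_3 = 'o_0) * (swap 'o_4 = 'o_1) * (swap 'o_5 = 'o_2).
Proof. by do !split; apply: code_at; rewrite code_swap. Qed.

Definition perm_at := (rot1_at, rot2_at, flip1_at, flip2_at, swap_at).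

Lemma code_inv g h : mulc (code g) (code h) = iota 0%N 6 -> g^-1 = h.
Proof. by rewrite -codeM -code1 => /code_inj/eqP; rewrite -eq_invg_mul => /eqP. Qed.

Lemma code_permutations g : code g \in permutations (iota 0%N 6).
Proof.
rewrite mem_permutations; apply: uniq_perm; rewrite ?iota_uniq //.
  rewrite map_inj_uniq // => i j /val_inj; exact: perm_inj.
have [||| _ e] := @uniq_min_size _ (code g) (iota 0%N 6).
- by rewrite map_inj_uniq // => i j /val_inj; exact: perm_inj.
- by move=> _ /mapP[i _ ->]; rewrite mem_iota /= ltn_ord.
- by rewrite size_map.
by move=> x; rewrite e.
Qed.

(** Whether the images of 0, 1, 2 lie in one block; those of 3, 4, 5 are then in the
    other one. *)
Definition block_code (l : seq nat) :=
  constant [seq (x < 3)%N | x <- take 3 l].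

Definition rotations : seq 'S_6 :=
  [seq x * y | x <- [:: 1; rot1; rot1 * rot1], y <- [:: 1; rot2; rot2 * rot2]].
Definition block_fixing : seq 'S_6 := [:: 1; flip1; flip2; flip1 * flip2].
Definition block_swapping : seq 'S_6 := [:: swap; flip1 * swap; flip2 * swap; flip1 * flip2 * swap].

Lemma code_rotations : [seq code d | d <- rotations] =
  [:: [:: 0; 1; 2; 3; 4; 5];
      [:: 0; 1; 2; 4; 5; 3];
      [:: 0; 1; 2; 5; 3; 4];
      [:: 1; 2; 0; 3; 4; 5];
      [:: 1; 2; 0; 4; 5; 3];
      [:: 1; 2; 0; 5; 3; 4];
      [:: 2; 0; 1; 3; 4; 5];
      [:: 2; 0; 1; 4; 5; 3];
      [:: 2; 0; 1; 5; 3; 4]]%N.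
Proof. by rewrite /rotations /= !codeE. Qed.
Lemma code_block_fixing : [seq code d | d <- block_fixing] =
  [:: [:: 0; 1; 2; 3; 4; 5];
      [:: 1; 0; 2; 3; 4; 5];
      [:: 0; 1; 2; 4; 3; 5];
      [:: 1; 0; 2; 4; 3; 5]]%N.
Proof. by rewrite /block_fixing /= !codeE. Qed.
Lemma code_block_swapping : [seq code d | d <- block_swapping] =
  [:: [:: 3; 4; 5; 0; 1; 2];
      [:: 4; 3; 5; 0; 1; 2];
      [:: 3; 4; 5; 1; 0; 2];
      [:: 4; 3; 5; 1; 0; 2]]%N.
Proof. by rewrite /block_swapping /= !codeE. Qed.

(** The permutations preserving the partition into blocks are the products of a
    rotation of each block and one of the 8 elements of the dihedral group; this is
    checked on the codes of all 720 permutations. *)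
Lemma block_decomposition g : block_code (code g) ->
  exists x d, [/\ x \in rotations,
    d \in (if (g 'o_0 < 3)%N then block_fixing else block_swapping) & g = x * d].
Proof.
move=> bg; pose D := if (g 'o_0 < 3)%N then block_fixing else block_swapping.
have: code g \in [seq mulc x y | x <- map code rotations, y <- map code D].
  have -> : D = if (nth 0 (code g) 0 < 3)%N then block_fixing else block_swapping.
    by rewrite (nth_code g 'o_0).
  have := code_permutations g; move: (code g) bg => l.
  rewrite [map _ (if _ then _ else _)]fun_if code_rotations code_block_fixing.
  rewrite code_block_swapping => bl lp; apply: (implyP _ bl); move: l lp {bl}.
  by apply/allP; vm_compute.
case/allpairsP=> [[u v] [/mapP[x xr def_u] /mapP[d dD def_v]]].
rewrite [u in mulc u]def_u [v in mulc _ v]def_v -codeM => /code_inj def_g.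
by exists x, d.
Qed.

Lemma rotations_mem (G : {group 'S_6}) : rot1 \in G -> rot2 \in G -> {subset rotations <= G}.
Proof. by move=> G1 G2; apply/allP; rewrite /= !groupM. Qed.

Ltac by_code := apply: code_inj; rewrite !codeE; vm_compute; reflexivity.

(** The flips and the swap span a dihedral group of order 8.  These are the subgroups
    of it that contain an element exchanging the blocks, together with the rotations. *)
Definition imprimitive_generators : seq (seq 'S_6) :=
  [:: [:: rot1; rot2; swap]; [:: rot1; rot2; flip1 * flip2 * swap];
      [:: rot1; rot2; flip1 * flip2; swap];
      [:: rot1; rot2; flip1 * swap]; [:: rot1; rot2; flip1; flip2; swap]].

(** By [block_decomposition], G is generated by the rotations and the elements of the
    dihedral group that it contains.  If flip1 * swap is one of them, then so is its
    square flip1 * flip2, and any element outside the cyclic group of order 4 gives the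
    whole dihedral group.  If not, then G contains no flip, since the product of a
    flip and an element exchanging the blocks is flip1 * swap or its inverse, unless
    that element is one of these two already. *)
Lemma imprimitive_classification (G : {group 'S_6}) g :
    rot1 \in G -> rot2 \in G -> {in G, forall h, block_code (code h)} ->
    g \in G -> (3 <= g 'o_0)%N ->
  exists2 A, A \in imprimitive_generators & G :=: <<[set x in A]>>.
Proof.
move=> Gr1 Gr2 blockG Gg swg; have GR := rotations_mem Gr1 Gr2.
have gen (A : seq 'S_6) : A \in imprimitive_generators -> all (mem G) A ->
    all [pred d | (d \in G) ==> (d \in <<[set x in A]>>)] (block_fixing ++ block_swapping) ->
  exists2 A, A \in imprimitive_generators & G :=: <<[set x in A]>>.
  move=> Agen /allP AG /allP DG; exists A => //.
  apply/eqP; rewrite eqEsubset gen_subG; apply/andP; split; last first.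
    by apply/subsetP=> h; rewrite inE => /AG.
  have [A1 A2] : rot1 \in A /\ rot2 \in A.
    by apply/andP; move: A Agen {AG DG}; apply/allP; rewrite /= !inE !eqxx ?orbT.
  apply/subsetP=> h Gh; have [x [d [xr dD def_h]]] := block_decomposition (blockG h Gh).
  rewrite def_h groupM //.
    by apply: rotations_mem xr; rewrite mem_gen // inE.
  have /DG/implyP : d \in block_fixing ++ block_swapping.
    by rewrite mem_cat; case: ifP dD => _ ->; rewrite ?orbT.
  by apply; rewrite -(groupMl d (GR x xr)) -def_h.
have [d dsw Gd] : exists2 d, d \in block_swapping & d \in G.
  have [x [d [xr dD def_g]]] := block_decomposition (blockG g Gg).
  exists d; first by move: dD; rewrite ltnNge swg.
  by rewrite -(groupMl d (GR x xr)) -def_g.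
have from (x y z : 'S_6) : x \in G -> y \in G -> code z = mulc (code x) (code y) ->
    z \in G.
  by move=> Gx Gy; rewrite -codeM => /code_inj->; apply: groupM.
have abG : flip1 * swap \in G -> flip1 * flip2 \in G.
  by move=> Gaw; apply: (from _ _ _ Gaw Gaw); rewrite !codeE.
have bwE : flip2 * swap = (flip1 * swap)^-1 by apply/esym/code_inv; rewrite !codeE.
have [awG|awG] := boolP (flip1 * swap \in G).
  have [aG|aG] := boolP (flip1 \in G).
    have wG : swap \in G by apply: (from _ _ _ aG awG); rewrite !codeE.
    have bG : flip2 \in G by apply: (from _ _ _ aG (abG awG)); rewrite !codeE.
    apply: (gen [:: rot1; rot2; flip1; flip2; swap]); first by rewrite !inE eqxx ?orbT.
      by rewrite /= Gr1 Gr2 aG bG wG.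
    by rewrite /= !(group1, groupM, implybT, mem_gen) // !inE eqxx ?orbT.
  have bG : flip2 \notin G.
    by apply: contra aG => bG; apply: (from _ _ _ (abG awG) bG); rewrite !codeE.
  have wG : swap \notin G.
    by apply: contra aG => wG; apply: (from _ _ _ awG wG); rewrite !codeE.
  have abwG : flip1 * flip2 * swap \notin G.
    by apply: contra bG => abwG; apply: (from _ _ _ awG abwG); rewrite !codeE.
  apply: (gen [:: rot1; rot2; flip1 * swap]); first by rewrite !inE eqxx ?orbT.
    by rewrite /= Gr1 Gr2 awG.
  set A := <<_>>; have awA : flip1 * swap \in A by rewrite mem_gen // !inE eqxx ?orbT.
  have abA : flip1 * flip2 \in A.
    suff -> : flip1 * flip2 = (flip1 * swap) * (flip1 * swap) by rewrite groupM.
    by apply: code_inj; rewrite !codeE.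
  rewrite /= (negPf aG) (negPf bG) (negPf wG) (negPf abwG) bwE !groupV.
  by rewrite !(group1, awA, abA, implybT).
have bwG : flip2 * swap \notin G by rewrite bwE groupV.
have aG : flip1 \notin G.
  apply: contra awG => aG; move: dsw Gd; rewrite !inE => /or4P[] /eqP-> wG.
  - by apply: (from _ _ _ aG wG); rewrite !codeE.
  - exact: wG.
  - by rewrite (negPf bwG) in wG.
  - rewrite -[flip1 * swap]invgK -bwE groupV.
    by apply: (from _ _ _ aG wG); rewrite !codeE.
have bG : flip2 \notin G.
  apply: contra awG => bG; move: dsw Gd; rewrite !inE => /or4P[] /eqP-> wG.
  - rewrite -[flip1 * swap]invgK -bwE groupV.
    by apply: (from _ _ _ bG wG); rewrite !codeE.
  - exact: wG.
  - by rewrite (negPf bwG) in wG.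
  - by apply: (from _ _ _ bG wG); rewrite !codeE.
have [abG'|abG'] := boolP (flip1 * flip2 \in G).
  have wG : swap \in G.
    move: dsw Gd; rewrite !inE => /or4P[] /eqP-> // wG.
    - by rewrite (negPf awG) in wG.
    - by rewrite (negPf bwG) in wG.
    - by apply: (from _ _ _ abG' wG); rewrite !codeE.
  apply: (gen [:: rot1; rot2; flip1 * flip2; swap]); first by rewrite !inE eqxx ?orbT.
    by rewrite /= Gr1 Gr2 abG' wG.
  set A := <<_>>; have wA : swap \in A by rewrite mem_gen // !inE eqxx ?orbT.
  have abA : flip1 * flip2 \in A by rewrite mem_gen // !inE eqxx ?orbT.
  rewrite /= (negPf aG) (negPf bG) (negPf awG) (negPf bwG).
  by rewrite (groupM abA wA) !(group1, wA, abA, implybT).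
have [wG|wG] := boolP (swap \in G).
  have abwG : flip1 * flip2 * swap \notin G.
    by apply: contra abG' => abwG; apply: (from _ _ _ abwG wG); rewrite !codeE.
  apply: (gen [:: rot1; rot2; swap]); first by rewrite !inE eqxx ?orbT.
    by rewrite /= Gr1 Gr2 wG.
  set A := <<_>>; have wA : swap \in A by rewrite mem_gen // !inE eqxx ?orbT.
  rewrite /= (negPf aG) (negPf bG) (negPf awG) (negPf bwG) (negPf abG') (negPf abwG).
  by rewrite !(group1, wA, implybT).
have abwG : flip1 * flip2 * swap \in G.
  move: dsw Gd; rewrite !inE => /or4P[] /eqP-> // wG'.
  - by rewrite (negPf wG) in wG'.
  - by rewrite (negPf awG) in wG'.
  - by rewrite (negPf bwG) in wG'.
apply: (gen [:: rot1; rot2; flip1 * flip2 * swap]); first by rewrite !inE eqxx ?orbT.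
  by rewrite /= Gr1 Gr2 abwG.
set A := <<_>>; have wA : flip1 * flip2 * swap \in A by rewrite mem_gen // !inE eqxx ?orbT.
rewrite /= (negPf aG) (negPf bG) (negPf awG) (negPf bwG) (negPf abG') (negPf wG).
by rewrite !(group1, wA, implybT).
Qed.

(** * Permutations breaking the blocks *)

(** The triple (a, b, c) stands for the three-cycle a -> b -> c -> a.  Plain numbers are
    used instead of ordinals so that conjugation computes. *)
Definition triple := (nat * nat * nat)%type.

Definition cyc3_fun (t : triple) (x : nat) : nat :=
  let: (a, b, c) := t in
  (if x == a then b else if x == b then c else if x == c then a else x)%N.

Definition conj_triple (t u : triple) : triple :=
  let: (a, b, c) := t in (cyc3_fun u a, cyc3_fun u b, cyc3_fun u c).

(** A search through the conjugates of the three-cycles in [todo] by those in [gens]. *)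
Fixpoint explore (gens : seq triple) fuel (todo seen : seq triple) :=
  if (fuel, todo) is (fuel'.+1, t :: todo') then
    let new := [seq u <- undup [seq conj_triple t g | g <- gens] | u \notin seen] in
    explore gens fuel' (new ++ todo') (new ++ seen)
  else seen.

(** There are 120 triples to visit. *)
Definition conj_closure (gens : seq triple) := explore gens 120 gens gens.

Definition good_triple (t : triple) :=
  let: (a, b, c) := t in uniq [:: a; b; c] && all (gtn 6) [:: a; b; c].

Definition all_triples : seq triple :=
  [seq t <- [seq (x, c) | x <- [seq (a, b) | a <- iota 0%N 6, b <- iota 0%N 6],
                          c <- iota 0%N 6] | good_triple t].

Definition cyc3_of (t : triple) : 'S_6 :=
  let: (a, b, c) := t in cyc3 (inord a) (inord b) (inord c).

Definition small_triple (t : triple) :=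
  let: (a, b, c) := t in all (gtn 6) [:: a; b; c].

Lemma good_small t : good_triple t -> small_triple t.
Proof. by case: t => [[a b] c] /andP[]. Qed.

Lemma cyc3_funE t x : good_triple t -> (x < 6)%N ->
  cyc3_of t (inord x) = inord (cyc3_fun t x).
Proof.
case: t => [[a b] c] /andP[Ut /and4P[/= a6 b6 c6 _]] x6; rewrite /cyc3_of /cyc3 permM.
have neq y z : (y < 6)%N -> (z < 6)%N -> y != z -> inord y != inord z :> 'I_6.
  by move=> y6 z6; apply: contra => /eqP/(congr1 val); rewrite /= !inordK // => ->.
move: Ut; rewrite /= !inE negb_or => /andP[/andP[ab ac]] /andP[bc _].
have [->|xa] := eqVneq x a; first by rewrite tpermL tpermD ?neq // eq_sym.
have [->|xb] := eqVneq x b; first by rewrite tpermR tpermL.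
have [->|xc] := eqVneq x c; first by rewrite [X in tperm _ _ X]tpermD ?neq // tpermR.
by rewrite !tpermD ?neq // eq_sym.
Qed.

Lemma small_conj t u : small_triple t -> small_triple u ->
  small_triple (conj_triple t u).
Proof.
case: t u => [[a b] c] [[x y] z] /and4P[/= a6 b6 c6 _] /and4P[/= x6 y6 z6 _].
by do ?[case: ifP => _ //]; rewrite /= ?a6 ?b6 ?c6 ?x6 ?y6 ?z6.
Qed.

Lemma conj_triple_mem (G : {group 'S_6}) t u :
    small_triple t -> good_triple u -> cyc3_of t \in G -> cyc3_of u \in G ->
  cyc3_of (conj_triple t u) \in G.
Proof.
move=> t6 gu Gt Gu.
suff -> : cyc3_of (conj_triple t u) = cyc3_of t ^ cyc3_of u by rewrite groupJ.
case: t t6 {Gt} => [[a b] c] /and4P[/= a6 b6 c6 _].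
by rewrite cyc3J !cyc3_funE.
Qed.

Lemma conj_closure_mem (G : {group 'S_6}) gens :
    all good_triple gens -> all [pred t | cyc3_of t \in G] gens ->
  {in conj_closure gens, forall t, cyc3_of t \in G}.
Proof.
move=> gg Gg; pose P t := small_triple t && (cyc3_of t \in G).
have Pgens : all P gens.
  by apply/allP=> t gt; rewrite /P good_small ?(allP gg) //; apply: (allP Gg).
suff Pex fuel todo seen : all P todo -> all P seen ->
    all P (explore gens fuel todo seen).
  rewrite /conj_closure; move: (Pex 120%N _ _ Pgens Pgens).
  by move: (explore _ _ _ _) => l /allP Pl t /Pl/andP[].
elim: fuel todo seen => [|fuel IH] [|t todo] seen //= /andP[Pt Ptodo] Pseen.
set new := [seq u <- _ | _]; have Pnew : all P new.
  apply/allP=> v; rewrite mem_filter mem_undup => /andP[_ /mapP[u gu ->]].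
  have [[t6 Gt] gdu] := (andP Pt, allP gg u gu).
  apply/andP; split; first exact: small_conj (good_small gdu).
  by apply: conj_triple_mem => //; apply: (allP Gg).
by apply: IH; rewrite all_cat Pnew.
Qed.

Lemma mem_all_triples a b c : good_triple (a, b, c) -> (a, b, c) \in all_triples.
Proof.
move=> gabc; rewrite mem_filter gabc andTb.
have [a6 b6 c6] : [/\ a < 6, b < 6 & c < 6]%N by case/and4P: (good_small gabc).
apply/allpairsPdep; exists (a, b), c; rewrite mem_iota c6; split=> //.
by apply/allpairsPdep; exists a, b; rewrite !mem_iota a6 b6.
Qed.

(** A three-cycle that meets both blocks, and the rotations, are enough to reach all
    three-cycles by conjugation. *)
Lemma conj_closure_all :
  all (fun t => [|| all (gtn 3) [:: t.1.1; t.1.2; t.2],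
      all (leq 3) [:: t.1.1; t.1.2; t.2] |
      all (mem (conj_closure [:: (0, 1, 2)%N; (3, 4, 5)%N; t])) all_triples])
    all_triples.
Proof. by vm_compute. Qed.

Opaque conj_closure all_triples.

Lemma cyc3_of012 : cyc3_of (0, 1, 2)%N = rot1.
Proof.
by rewrite rot1.unlock; congr (tperm _ _ * tperm _ _); apply: val_inj;
  rewrite /= inordK.
Qed.

Lemma cyc3_of345 : cyc3_of (3, 4, 5)%N = rot2.
Proof.
by rewrite rot2.unlock; congr (tperm _ _ * tperm _ _); apply: val_inj;
  rewrite /= inordK.
Qed.

(** The conjugate of rot1 by g is a three-cycle that meets both blocks. *)
Lemma primitive_Alt (G : {group 'S_6}) g :
    rot1 \in G -> rot2 \in G -> g \in G -> ~~ block_code (code g) ->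
  'Alt_('I_6) \subset G.
Proof.
move=> Gr1 Gr2 Gg nblock.
pose t : triple := (val (g 'o_0), val (g 'o_1), val (g 'o_2)).
have ordE (i : 'I_6) : inord i = i by apply: inord_val.
have gt : good_triple t.
  rewrite /t /= !ltn_ord !inE !andbT negb_or !val_eqE !(inj_eq perm_inj).
  by rewrite -!val_eqE.
have Gt : cyc3_of t \in G.
  rewrite /t /cyc3_of !ordE -cyc3J groupJ //.
  by move: Gr1; rewrite rot1.unlock.
have closed : {in all_triples, forall u, cyc3_of u \in G}.
  have := allP conj_closure_all t; rewrite mem_all_triples // => /(_ isT).
  have -> : all (gtn 3) [:: t.1.1; t.1.2; t.2] = false.
    apply: contraNF nblock; rewrite /block_code /code /=.
    by case/and4P=> -> -> ->.
  have -> : all (leq 3) [:: t.1.1; t.1.2; t.2] = false.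
    apply: contraNF nblock; rewrite /block_code /code /=.
    by case/and4P=> h0 h1 h2 _; rewrite !(ltnNge _ 3%N) h0 h1 h2.
  rewrite !orFb => /allP cl u /cl; apply: conj_closure_mem; first by rewrite /all gt.
  apply/and4P; split=> //.
    by change (cyc3_of (0, 1, 2)%N \in G); rewrite cyc3_of012.
  by change (cyc3_of (3, 4, 5)%N \in G); rewrite cyc3_of345.
apply: Alt_sub_cyc3 => i j k Uijk.
rewrite -(ordE i) -(ordE j) -(ordE k); apply: (closed (val i, val j, val k)).
apply: mem_all_triples; rewrite /= !ltn_ord !andbT.
by move: Uijk; rewrite /= !inE -!val_eqE andbT.
Qed.

(** * The transitive groups *)

Lemma order_rot (r : 'S_6) : r \in [:: rot1; rot2] -> #[r] = 3%N.
Proof.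
move=> rr; apply: nt_prime_order => //; move: rr; rewrite !inE => /orP[]/eqP->.
- by apply: code_inj; rewrite !expgS expg0 !codeE.
- by apply: code_inj; rewrite !expgS expg0 !codeE.
- by apply/eqP=> /(congr1 code); rewrite !codeE.
- by apply/eqP=> /(congr1 code); rewrite !codeE.
Qed.

Lemma card_rotation_group : #|<[rot1]> <*> <[rot2]>| = 9%N.
Proof.
have r12 : rot1 * rot2 = rot2 * rot1 by apply: code_inj; rewrite !codeE.
have r21C : <[rot2]> \subset 'C(<[rot1]>).
  by rewrite cent_cycle cycle_subG; apply/cent1P/commute_sym.
have [o1 o2] : #[rot1] = 3%N /\ #[rot2] = 3%N by split; apply: order_rot; rewrite !inE eqxx ?orbT.
rewrite cent_joinEr // TI_cardMg ?[#|_|]o1 ?[#|<[rot2]>|]o2 //.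
apply: prime_TIg; first by rewrite [#|_|]o1.
rewrite cycle_subG; apply/negP=> /cycleP[k def_r1].
have fix0 m : (rot2 ^+ m) 'o_0 = 'o_0.
  elim: m => [|m IHm]; first by rewrite perm1.
  by rewrite expgSr permM IHm; apply: val_inj; rewrite -[LHS]nth_code code_rot2.
by have := congr1 val (fix0 k); rewrite -def_r1 -[LHS]nth_code code_rot1.
Qed.

(** Both groups are Sylow 3-subgroups of S_6. *)
Lemma conj_contains_rotations (H : {group 'S_6}) :
  H \isog [set: 'Z_3 * 'Z_3] -> exists x, rot1 \in H :^ x /\ rot2 \in H :^ x.
Proof.
move/card_isog; rewrite cardsT card_prod !card_ord => cardH.
have syl (Q : {group 'S_6}) : #|Q| = 9%N -> 3.-Sylow([set: 'S_6]) Q.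
  move=> cardQ; rewrite pHallE subsetT cardQ cardsT card_Sn p_part.
  (* 720 = 2^4 * 3^2 * 5 *)
  by vm_compute.
have [x _ def_N] := Sylow_trans (syl H cardH) (syl (<[rot1]> <*> <[rot2]>)%G card_rotation_group).
exists x; rewrite -def_N; split; apply: mem_gen; rewrite inE cycle_id ?orbT //.
Qed.

Theorem transitive_classification (G : {group 'S_6}) :
    [transitive G, on [set: 'I_6] | 'P] ->
    (exists2 H : {group 'S_6}, H \subset G & H \isog [set: 'Z_3 * 'Z_3]) ->
  [\/ G :=: 'Alt_('I_6), G :=: [set: 'S_6] |
      exists x A, A \in imprimitive_generators /\ (G :^ x)%G :=: <<[set y in A]>>].
Proof.
move=> transG [H sHG /conj_contains_rotations[x [H1 H2]]].
have [G1 G2] : rot1 \in (G :^ x)%G /\ rot2 \in (G :^ x)%G.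
  by split; apply: subsetP H1 || apply: subsetP H2; rewrite conjSg.
have [blockG|] := boolP [forall h in (G :^ x)%G, block_code (code h)].
  have [g Gg /esym gx] := atransP2 transG (in_setT (x^-1 'o_0)) (in_setT (x^-1 'o_3)).
  have Gx : g ^ x \in (G :^ x)%G by rewrite memJ_conjg.
  have gx3 : (g ^ x) 'o_0 = 'o_3.
    by rewrite conjgE !permM; move: gx; rewrite /= /aperm => ->; rewrite permKV.
  have [||A Agen defG] := imprimitive_classification G1 G2 _ Gx.
  - by move=> h; apply: (forall_inP blockG).
  - by rewrite gx3.
  by apply: Or33; exists x, A.
rewrite negb_forall_in => /exists_inP[h Gh /(primitive_Alt G1 G2 Gh)].
rewrite -sub_conjgV => sAG.
have nA : 'Alt_('I_6) :^ x^-1 = 'Alt_('I_6).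
  by apply: normP; apply: (subsetP (Alt_norm _)); rewrite inE.
by case: (@Alt_or_Sym _ G _) => [|defG|defG];
  [rewrite -nA | apply: Or31 | apply: Or32].
Qed.

Local Close Scope group_scope.

(** * Generators of fixed fields of small groups *)

Ltac field_mem :=
  repeat first [assumption | match goal with
  | |- is_true (in_mem (GRing.add _ (GRing.opp _)) _) => apply: rpredB
  | |- is_true (in_mem (GRing.add _ _) _) => apply: rpredD
  | |- is_true (in_mem (GRing.mul _ (GRing.inv _)) _) => apply: rpred_div
  | |- is_true (in_mem (GRing.mul _ _) _) => apply: rpredM
  | |- is_true (in_mem (GRing.opp _) _) => rewrite rpredN
  | |- is_true (in_mem (GRing.exp _ _) _) => apply: rpredX
  | |- is_true (in_mem (GRing.natmul _ _) _) => apply: rpredMn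
  | |- is_true (in_mem (GRing.one _) _) => apply: rpred1
  end].

Section Towers.

Variables (L : fieldType) (k : divringClosed L).
Implicit Types (s : seq L) (sigma : {rmorphism L -> L}).

Lemma fixes_adjoin s sigma :
    {in k, forall c, sigma c = c} -> {in s, forall x, sigma x = x} ->
  {in adjoin k s, forall x, sigma x = x}.
Proof.
move=> sk ss x /adjoinP; elim=> {x} [x /sk|x /ss||x y _ Ex _ Ey|x y _ Ex _ Ey] //.
- exact: rmorph1.
- by rewrite rmorphB /= Ex Ey.
- by rewrite fmorph_div /= Ex Ey.
Qed.

Lemma adjoin_step s s' b :
    {in s', forall x, x \in adjoin k (b :: s)} ->
  {subset adjoin k s' <= adjoin (adjoin k s) [:: b]}.
Proof.
move=> s'P; apply: adjoin_sub => x; first by move=> kx; do 2!apply: sub_adjoin.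
move=> /s'P; apply: adjoin_sub => {}x; first by move=> kx; do 2!apply: sub_adjoin.
rewrite inE => /predU1P[->|sx]; first exact/mem_adjoin/mem_head.
exact/sub_adjoin/mem_adjoin.
Qed.

(** [fixed_descent] in terms of generators: s generates E and s' is contained in E(b), of
    degree 2 over E. *)
Lemma quadratic_descent s s' sigma b f :
    {in k, forall c, sigma c = c} -> all (fun x => sigma x == x) s ->
    sigma b != b -> b + sigma b \in adjoin k s -> b * sigma b \in adjoin k s ->
    all (mem (adjoin k (b :: s))) s' ->
  sigma f = f -> f \in adjoin k s' -> f \in adjoin k s.
Proof.
move=> sk ss sb sumb prodb s'P sf /(adjoin_step (allP s'P)) fs.
apply: (fixed_descent (sigma := sigma) (b := b) (m := 1)) fs sf.
- exact: fixes_adjoin sk (fun x sx => eqP (allP ss x sx)).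
- by rewrite /= inE eq_sym sb.
rewrite /= !big_cons big_nil mulr1.
have -> : ('X - b%:P) * ('X - (sigma b)%:P) =
    'X ^+ 2 - (b + sigma b)%:P * 'X + (b * sigma b)%:P.
  by rewrite rmorphD rmorphM /=; ring.
by rewrite rpredD ?rpredB ?rpredM ?polyOverC ?polyOverX.
Qed.

Lemma cubic_descent s s' sigma b f :
    {in k, forall c, sigma c = c} -> all (fun x => sigma x == x) s ->
    uniq [:: b; sigma b; sigma (sigma b)] ->
    b + sigma b + sigma (sigma b) \in adjoin k s ->
    b * sigma b + sigma b * sigma (sigma b) + sigma (sigma b) * b \in adjoin k s ->
    b * sigma b * sigma (sigma b) \in adjoin k s ->
    all (mem (adjoin k (b :: s))) s' ->
  sigma f = f -> f \in adjoin k s' -> f \in adjoin k s.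
Proof.
move=> sk ss Ub e1 e2 e3 s'P sf /(adjoin_step (allP s'P)) fs.
apply: (fixed_descent (sigma := sigma) (b := b) (m := 2)) fs sf => //.
  exact: fixes_adjoin sk (fun x sx => eqP (allP ss x sx)).
rewrite /= !big_cons big_nil mulr1; set c := sigma b in Ub e1 e2 e3 *.
set d := sigma c in Ub e1 e2 e3 *.
have -> : ('X - b%:P) * (('X - c%:P) * ('X - d%:P)) =
    'X ^+ 3 - (b + c + d)%:P * 'X ^+ 2 + (b * c + c * d + d * b)%:P * 'X
    - (b * c * d)%:P.
  by rewrite !rmorphD !rmorphM /=; ring.
by rewrite rpredB ?rpredD ?rpredN ?rpredM ?polyOverC ?rpredX ?polyOverX.
Qed.

End Towers.

Section Masuda.

Variable L : fieldType.
Implicit Types (x y z : L).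

(** The product of x + w y + w^2 z and x + w^2 y + w z, for w a primitive cube root of 1. *)
Definition disc_form x y z :=
  x ^+ 2 + y ^+ 2 + z ^+ 2 - x * y - y * z - z * x.

(** Masuda's invariant u of the rotation x -> y -> z -> x; the other one, v, is obtained by
    exchanging x and y. *)
Definition masuda x y z :=
  (x * y ^+ 2 + y * z ^+ 2 + z * x ^+ 2 - 3 * x * y * z) / disc_form x y z.

Lemma disc_form_rot x y z : disc_form y z x = disc_form x y z.
Proof. by rewrite /disc_form; ring. Qed.
Lemma disc_form_swap x y z : disc_form y x z = disc_form x y z.
Proof. by rewrite /disc_form; ring. Qed.

Lemma masuda_rot x y z : masuda y z x = masuda x y z.
Proof. by rewrite /masuda disc_form_rot; congr (_ / _); ring. Qed.

Lemma rmorph_masuda (sigma : {rmorphism L -> L}) x y z :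
  sigma (masuda x y z) = masuda (sigma x) (sigma y) (sigma z).
Proof.
rewrite /masuda /disc_form fmorph_div.
by rewrite !(rmorph_nat, rmorphB, rmorphD, rmorphM, rmorphXn).
Qed.

Section Relations.

Variables x y z : L.
Hypothesis D0 : disc_form x y z != 0.
Let u := masuda x y z.
Let v := masuda y x z.
Let q := u ^+ 2 - u * v + v ^+ 2.

Let vE : v = (y * x ^+ 2 + x * z ^+ 2 + z * y ^+ 2 - 3 * y * x * z) / disc_form x y z.
Proof. by rewrite /v /masuda disc_form_swap. Qed.

Lemma masuda_e2 : x * y + y * z + z * x = (x + y + z) * (u + v) - 3 * q.
Proof. by move: D0; rewrite /q vE /u /masuda /disc_form => D; field. Qed.

Lemma masuda_e3 : x * y * z = (x + y + z) * (u * v) - q * (u + v).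
Proof. by move: D0; rewrite /q vE /u /masuda /disc_form => D; field. Qed.

(** On x the rotation acts by the homography X |-> (v X - q) / (X - u), whose
    coefficients are invariant. *)
Lemma masuda_mobius : y * (x - u) = v * x - q.
Proof. by move: D0; rewrite /q vE /u /masuda /disc_form => D; field. Qed.

Lemma masuda_sub : x - u = (x - y) * (x - z) ^+ 2 / disc_form x y z.
Proof. by move: D0; rewrite /u /masuda /disc_form => D; field. Qed.

End Relations.
End Masuda.

Section Generators.

Variables (L : fieldType) (k : divringClosed L).
Implicit Types (s : seq L) (sigma : {rmorphism L -> L}).

Lemma adjoin_nth s i : (i < size s)%N -> s`_i \in adjoin k s.
Proof. by move=> lti; apply/mem_adjoin/mem_nth. Qed.

Lemma adjoin_up s b x : x \in adjoin k s -> x \in adjoin k (b :: s).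
Proof.
apply: adjoin_sub => y; first exact: sub_adjoin.
by move=> sy; apply: mem_adjoin; rewrite in_cons sy orbT.
Qed.

Lemma adjoin_head s b : b \in adjoin k (b :: s).
Proof. exact/mem_adjoin/mem_head. Qed.

Lemma adjoin_all s : all (mem (adjoin k s)) s.
Proof. by apply/allP=> x; apply: mem_adjoin. Qed.

(** By [masuda_e2] and [masuda_e3] the elementary symmetric functions of x, y, z are
    polynomials in s, u, v, so x is cubic over the field of these invariants, and y is
    obtained from x by the homography of [masuda_mobius]. *)
Lemma masuda_generators sigma x y z s f :
    {in k, forall c, sigma c = c} -> all (fun x => sigma x == x) s ->
    sigma x = y -> sigma y = z -> sigma z = x ->
    uniq [:: x; y; z] -> disc_form x y z != 0 -> sigma f = f ->
    f \in adjoin k [:: x, y, z & s] ->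
  f \in adjoin k [:: x + y + z, masuda x y z, masuda y x z & s].
Proof.
move=> sk ss sx sy sz Uxyz D0 sf.
set u := masuda x y z; set v := masuda y x z; set s' := [:: x + y + z, u, v & s].
have [xy xz] : x != y /\ x != z by move: Uxyz; rewrite /= !inE; do 2!case: eqP.
have eS : x + y + z \in adjoin k s' by apply: (@adjoin_nth s' 0%N).
have uS : u \in adjoin k s' by apply: (@adjoin_nth s' 1%N).
have vS : v \in adjoin k s' by apply: (@adjoin_nth s' 2%N).
apply: (cubic_descent (sigma := sigma) (b := x)) sf => //; rewrite ?sx ?sy //=.
- rewrite ss andbT; apply/and3P; split; apply/eqP.
  + by rewrite !rmorphD /= sx sy sz; ring.
  + by rewrite rmorph_masuda sx sy sz masuda_rot.
  + by rewrite rmorph_masuda sx sy sz -masuda_rot.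
- by rewrite masuda_e2 //; field_mem.
- by rewrite masuda_e3 //; field_mem.
have {}eS : x + y + z \in adjoin k (x :: s') by apply: (@adjoin_nth (x :: s') 1%N).
have {}uS : u \in adjoin k (x :: s') by apply: (@adjoin_nth (x :: s') 2%N).
have {}vS : v \in adjoin k (x :: s') by apply: (@adjoin_nth (x :: s') 3%N).
have xS : x \in adjoin k (x :: s') by apply: (@adjoin_nth (x :: s') 0%N).
have xu : x - u != 0.
  have [xy0 xz0] : x - y != 0 /\ x - z != 0 by rewrite !subr_eq0.
  by rewrite masuda_sub // !mulf_neq0 ?expf_neq0 ?invr_neq0.
have yS : y \in adjoin k (x :: s').
  have -> : y = (v * x - (u ^+ 2 - u * v + v ^+ 2)) / (x - u).
    by rewrite -masuda_mobius // mulfK.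
  by field_mem.
have -> : z = (x + y + z) - x - y by ring.
apply/and4P; split=> //; first by field_mem.
by apply/allP=> w sw; apply: mem_adjoin; rewrite !in_cons sw !orbT.
Qed.

Definition pair_gens (p q p' q' p'' q'' : L) : seq L :=
  [:: p + q; p * q; p' + q'; p * q' + q * p'; p'' + q''; p * q'' + q * p''].

Lemma pair_gens_sub (E : divringClosed L) p q p' q' p'' q'' :
    p \in E -> q \in E -> p' \in E -> q' \in E -> p'' \in E -> q'' \in E ->
  all (mem E) (pair_gens p q p' q' p'' q'').
Proof.
move=> Ep Eq Ep' Eq' Ep'' Eq''; rewrite /=; apply/and5P; split; last (apply/and3P; split=> //).
all: by field_mem.
Qed.

Lemma pair_gens_fixed sigma p q p' q' p'' q'' :
    sigma p = q -> sigma q = p -> sigma p' = q' -> sigma q' = p' ->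
    sigma p'' = q'' -> sigma q'' = p'' ->
  all (fun x => sigma x == x) (pair_gens p q p' q' p'' q'').
Proof.
move=> sp sq sp' sq' sp'' sq''.
rewrite /= !rmorphD !rmorphM /= sp sq sp' sq' sp'' sq''.
by rewrite (addrC q p) (mulrC q p) (addrC q') (addrC q'') !(addrC (q * _)) !eqxx.
Qed.

Lemma pair_gens_stable sigma p q p' q' p'' q'' :
    sigma p = p -> sigma q = q -> sigma p' = p' -> sigma q' = q' ->
    sigma p'' = p'' -> sigma q'' = q'' ->
  all (fun x => sigma x == x) (pair_gens p q p' q' p'' q'').
Proof.
move=> sp sq sp' sq' sp'' sq''.
by rewrite /= !rmorphD !rmorphM /= sp sq sp' sq' sp'' sq'' !eqxx.
Qed.

(** p is quadratic over the field of the generators, and p', q' solve the linear system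
    with right-hand sides p' + q' and p q' + q p', of determinant p - q. *)
Lemma pair_generators sigma p q p' q' p'' q'' f :
    {in k, forall c, sigma c = c} -> sigma p = q -> sigma q = p ->
    sigma p' = q' -> sigma q' = p' -> sigma p'' = q'' -> sigma q'' = p'' ->
    p != q -> sigma f = f -> f \in adjoin k [:: p; q; p'; q'; p''; q''] ->
  f \in adjoin k (pair_gens p q p' q' p'' q'').
Proof.
move=> sk sp sq sp' sq' sp'' sq'' pq sf; set s := pair_gens _ _ _ _ _ _.
apply: (quadratic_descent (sigma := sigma) (b := p)) sf => //; rewrite ?sp //.
- exact: pair_gens_fixed.
- by rewrite eq_sym.
- exact: (@adjoin_nth s 0%N).
- exact: (@adjoin_nth s 1%N).
have gen i : (i < 7)%N -> (p :: s)`_i \in adjoin k (p :: s).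
  by move=> lti; apply: adjoin_nth.
have G0 : p \in adjoin k (p :: s) := gen 0%N isT.
have G1 : p + q \in adjoin k (p :: s) := gen 1%N isT.
have G3 : p' + q' \in adjoin k (p :: s) := gen 3%N isT.
have G4 : p * q' + q * p' \in adjoin k (p :: s) := gen 4%N isT.
have G5 : p'' + q'' \in adjoin k (p :: s) := gen 5%N isT.
have G6 : p * q'' + q * p'' \in adjoin k (p :: s) := gen 6%N isT.
have Gq : q \in adjoin k (p :: s).
  have -> : q = p + q - p by ring.
  by field_mem.
have pq0 : p - q != 0 by rewrite subr_eq0.
have Gp' : p' \in adjoin k (p :: s).
  have -> : p' = (p * (p' + q') - (p * q' + q * p')) / (p - q) by field.
  by field_mem.
have Gp'' : p'' \in adjoin k (p :: s).
  have -> : p'' = (p * (p'' + q'') - (p * q'' + q * p'')) / (p - q) by field.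
  by field_mem.
have Gq' : q' \in adjoin k (p :: s).
  have -> : q' = p' + q' - p' by ring.
  by field_mem.
have Gq'' : q'' \in adjoin k (p :: s).
  have -> : q'' = p'' + q'' - p'' by ring.
  by field_mem.
by rewrite /= G0 Gq Gp' Gq' Gp'' Gq''.
Qed.


Section Quadruple.

Variables (u1 v1 u2 v2 s1 s2 : L).
Hypotheses (P0 : u1 + v1 - u2 - v2 != 0) (Q0 : u1 + u2 - v1 - v2 != 0).

(** All groups below act on s1, s2 as they act on u1 + v1, u2 + v2.  Hence s1 and s2 can be
    replaced by two invariants, linear in them, of determinant u2 + v2 - (u1 + v1). *)
Definition linear_gens : seq L := [:: s1 + s2; s1 * (u1 + v1) + s2 * (u2 + v2)].

(** The Klein group permutes u1, v1, u2, v2 simply transitively.  Let S be their sum and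
    P, Q, R the three denominators below, which the group only changes in sign.  Away
    from characteristic 2 the natural invariants are S and the quotients Q R / P,
    P R / Q, P Q / R, but in characteristic 2 all of these are S.  The identities
    P Q = R (S - 4 a3) and the like define a1, a2, a3, which make sense in every
    characteristic. *)
Definition V4_gens : seq L :=
  [:: u1 + v1 + u2 + v2,
      (u1 * v1 - u2 * v2) / (u1 + v1 - u2 - v2),
      (u1 * u2 - v1 * v2) / (u1 + u2 - v1 - v2),
      (u1 * v2 - v1 * u2) / (u1 + v2 - v1 - u2) & linear_gens].

(** Generators S, D, B, C for the cyclic permutation u1 -> u2 -> v1 -> v2 -> u1.  D is the
    quotient of (u1 - v1)(u2 - v2) by p1 - p2, where p1 = u1 + v1 and p2 = u2 + v2.  C is
    chosen so that (u1 + u2)(v1 + v2) = C + p2 D, and hence (u2 + v1)(u1 + v2) = C + p1 D. *)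
Definition C4_gens : seq L :=
  [:: u1 + v1 + u2 + v2,
      (u1 - v1) * (u2 - v2) / (u1 + v1 - u2 - v2),
      (u1 * v1 - u2 * v2) / (u1 + v1 - u2 - v2),
      ((u1 + v1) * (u1 + u2) * (v1 + v2) - (u2 + v2) * (u2 + v1) * (u1 + v2)) /
        (u1 + v1 - u2 - v2) & linear_gens].

Section Membership.

Variable E : divringClosed L.
Hypotheses (u1E : u1 \in E) (v1E : v1 \in E) (u2E : u2 \in E) (v2E : v2 \in E)
  (s1E : s1 \in E) (s2E : s2 \in E).

Lemma linear_gens_sub : all (mem E) linear_gens.
Proof. by rewrite /=; apply/and3P; split=> //; field_mem. Qed.

Lemma V4_gens_sub : all (mem E) V4_gens.
Proof. rewrite /=; apply/and5P; split; last exact: linear_gens_sub; by field_mem. Qed.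

Lemma C4_gens_sub : all (mem E) C4_gens.
Proof. rewrite /=; apply/and5P; split; last exact: linear_gens_sub; by field_mem. Qed.

End Membership.

Let divNN (a b : L) : a / b = (- a) / (- b).
Proof. by rewrite invrN mulrNN. Qed.

Lemma linear_gens_stable sigma :
    sigma (u1 + v1) = u1 + v1 -> sigma (u2 + v2) = u2 + v2 ->
    sigma s1 = s1 -> sigma s2 = s2 ->
  all (fun x => sigma x == x) linear_gens.
Proof. by move=> e1 e2 e3 e4; rewrite /= 2!rmorphD !rmorphM /= e1 e2 e3 e4 !eqxx. Qed.

Lemma linear_gens_swap sigma :
    sigma (u1 + v1) = u2 + v2 -> sigma (u2 + v2) = u1 + v1 ->
    sigma s1 = s2 -> sigma s2 = s1 ->
  all (fun x => sigma x == x) linear_gens.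
Proof.
move=> e1 e2 e3 e4; rewrite /= 2!rmorphD !rmorphM /= e1 e2 e3 e4.
by rewrite (addrC s2) (addrC (s2 * _)) !eqxx.
Qed.

Lemma linear_gens_solve (E : divringClosed L) :
    u1 + v1 \in E -> u2 + v2 \in E -> s1 + s2 \in E ->
    s1 * (u1 + v1) + s2 * (u2 + v2) \in E ->
  s1 \in E /\ s2 \in E.
Proof.
move=> p1E p2E E1 E2; have s1E : s1 \in E.
  have -> : s1 = (s1 * (u1 + v1) + s2 * (u2 + v2) - (u2 + v2) * (s1 + s2)) /
                 (u1 + v1 - (u2 + v2)) by field; rewrite opprD addrA.
  by field_mem.
by split=> //; have -> : s2 = s1 + s2 - s1 by [ring]; field_mem.
Qed.

Section Klein.

Variables alpha omega : {rmorphism L -> L}.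
Hypotheses (au1 : alpha u1 = v1) (av1 : alpha v1 = u1)
  (au2 : alpha u2 = v2) (av2 : alpha v2 = u2)
  (as1 : alpha s1 = s1) (as2 : alpha s2 = s2).
Hypotheses (wu1 : omega u1 = u2) (wv1 : omega v1 = v2)
  (wu2 : omega u2 = u1) (wv2 : omega v2 = v1)
  (ws1 : omega s1 = s2) (ws2 : omega s2 = s1).
Hypotheses (ak : {in k, forall c, alpha c = c}) (wk : {in k, forall c, omega c = c}).

Lemma V4_gens_fixed1 : all (fun x => alpha x == x) V4_gens.
Proof.
have la : all (fun x => alpha x == x) linear_gens.
  by apply: linear_gens_stable; rewrite // rmorphD /= ?au1 ?av1 ?au2 ?av2 addrC.
rewrite /V4_gens; apply/and5P; split=> //; apply/eqP;
  rewrite ?fmorph_div !(rmorphD, rmorphN, rmorphM) /= ?(au1, av1, au2, av2);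
  first [by ring | by congr (_ / _); ring | by rewrite divNN; congr (_ / _); ring].
Qed.

Lemma V4_gens_fixed2 : all (fun x => omega x == x) V4_gens.
Proof.
have lw : all (fun x => omega x == x) linear_gens.
  by apply: linear_gens_swap; rewrite // rmorphD /= ?wu1 ?wv1 ?wu2 ?wv2.
rewrite /V4_gens; apply/and5P; split=> //; apply/eqP;
  rewrite ?fmorph_div !(rmorphD, rmorphN, rmorphM) /= ?(wu1, wv1, wu2, wv2);
  first [by ring | by congr (_ / _); ring | by rewrite divNN; congr (_ / _); ring].
Qed.

Hypothesis R0 : u1 + v2 - v1 - u2 != 0.

(** Put p1 = u1 + v1 and q1 = u1 + u2.  Over the field of the generators p1 is quadratic, with
    conjugate S - p1 under omega, and then q1 is quadratic, with conjugate S - q1 under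
    alpha; finally u1 is rational in p1, q1, a3 and S. *)
Lemma V4_generators f : alpha f = f -> omega f = f ->
  f \in adjoin k [:: u1; v1; u2; v2; s1; s2] -> f \in adjoin k V4_gens.
Proof.
move=> af wf fL.
pose S := u1 + v1 + u2 + v2; pose p1 := u1 + v1; pose q1 := u1 + u2.
pose a1 := (u1 * v1 - u2 * v2) / (u1 + v1 - u2 - v2).
pose a2 := (u1 * u2 - v1 * v2) / (u1 + u2 - v1 - v2).
pose a3 := (u1 * v2 - v1 * u2) / (u1 + v2 - v1 - u2).
have gen i : (i < 6)%N -> V4_gens`_i \in adjoin k V4_gens.
  by move=> lti; apply: adjoin_nth.
have S_in : S \in adjoin k V4_gens := gen 0%N isT.
have a1_in : a1 \in adjoin k V4_gens := gen 1%N isT.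
have a2_in : a2 \in adjoin k V4_gens := gen 2%N isT.
have a3_in : a3 \in adjoin k V4_gens := gen 3%N isT.
have {fL} fE : f \in adjoin k (p1 :: V4_gens).
  have q1C : alpha q1 = v1 + v2 by rewrite rmorphD /= au1 au2.
  apply: (quadratic_descent (sigma := alpha) (b := q1)) af fL => //; rewrite ?q1C.
  - apply/andP; split; last exact: V4_gens_fixed1.
    by rewrite rmorphD /= au1 av1 addrC.
  - by rewrite eq_sym -subr_eq0 opprD addrA.
  - have -> : q1 + (v1 + v2) = S by rewrite /q1 /S; ring.
    exact: adjoin_up.
  - have -> : q1 * (v1 + v2) = S * (a1 + a3) - 4 * a1 * a3.
      by rewrite /q1 /S /a1 /a3; field; rewrite P0 R0.
    by apply: adjoin_up; field_mem.
  set F := adjoin k _.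
  have p1F : p1 \in F by apply/adjoin_up/adjoin_head.
  have q1F : q1 \in F by apply: adjoin_head.
  have SF : S \in F by do 2!apply: adjoin_up.
  have a3F : a3 \in F by do 2!apply: adjoin_up.
  have den : S - 4 * a3 != 0.
    have -> : S - 4 * a3 = (u1 + v1 - u2 - v2) * (u1 + u2 - v1 - v2) /
                           (u1 + v2 - v1 - u2) by rewrite /S /a3; field.
    by rewrite !mulf_neq0 ?invr_neq0.
  have u1F : u1 \in F.
    have -> : u1 = (p1 * q1 + a3 * (S - 2 * p1 - 2 * q1)) / (S - 4 * a3).
      by apply: (mulIf den); rewrite divfK // /S /a3 /p1 /q1; field.
    by field_mem.
  have v1F : v1 \in F by have -> : v1 = p1 - u1 by [rewrite /p1; ring]; field_mem.
  have u2F : u2 \in F by have -> : u2 = q1 - u1 by [rewrite /q1; ring]; field_mem.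
  have v2F : v2 \in F.
    by have -> : v2 = S - u1 - v1 - u2 by [rewrite /S; ring]; field_mem.
  have [||||s1F s2F] := @linear_gens_solve F; try by field_mem.
  + by do 2!apply: adjoin_up; apply: (gen 4%N).
  + by do 2!apply: adjoin_up; apply: (gen 5%N).
  by rewrite /= u1F v1F u2F v2F s1F s2F.
have p1C : omega p1 = u2 + v2 by rewrite rmorphD /= wu1 wv1.
apply: (quadratic_descent (sigma := omega) (b := p1)) wf fE => //; rewrite ?p1C.
- exact: V4_gens_fixed2.
- by rewrite eq_sym -subr_eq0 opprD addrA.
- by have -> : p1 + (u2 + v2) = S by [rewrite /p1 /S; ring].
- have -> : p1 * (u2 + v2) = S * (a2 + a3) - 4 * a2 * a3.
    by rewrite /p1 /S /a2 /a3; field; rewrite Q0 R0.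
  by field_mem.
exact: adjoin_all.
Qed.

End Klein.

Section Cyclic.

Variable rho : {rmorphism L -> L}.
Hypotheses (ru1 : rho u1 = u2) (ru2 : rho u2 = v1)
  (rv1 : rho v1 = v2) (rv2 : rho v2 = u1)
  (rs1 : rho s1 = s2) (rs2 : rho s2 = s1) (rk : {in k, forall c, rho c = c}).

Lemma C4_gens_fixed : all (fun x => rho x == x) C4_gens.
Proof.
have lr : all (fun x => rho x == x) linear_gens.
  by apply: linear_gens_swap; rewrite // rmorphD /= ?ru1 ?rv1 ?ru2 ?rv2 // addrC.
rewrite /C4_gens; apply/and5P; split=> //; apply/eqP;
  rewrite ?fmorph_div !(rmorphD, rmorphN, rmorphM) /= ?(ru1, ru2, rv1, rv2);
  first [by ring | by congr (_ / _); ring | by rewrite divNN; congr (_ / _); ring].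
Qed.

Hypothesis N0 : (u1 - v1) ^+ 2 + (u2 - v2) ^+ 2 != 0.

(** Put p1 = u1 + v1 and h = u1 + u2.  Over the field of the generators p1 is quadratic, with
    conjugate S - p1 under rho, and then h is quadratic, with conjugate S - h under the
    square of rho; finally u1 is rational in p1, h, B and S. *)
Lemma C4_generators f : rho f = f ->
  f \in adjoin k [:: u1; v1; u2; v2; s1; s2] -> f \in adjoin k C4_gens.
Proof.
move=> rf fL.
pose S := u1 + v1 + u2 + v2; pose p1 := u1 + v1; pose h := u1 + u2.
pose D := (u1 - v1) * (u2 - v2) / (u1 + v1 - u2 - v2).
pose B := (u1 * v1 - u2 * v2) / (u1 + v1 - u2 - v2).
pose C := ((u1 + v1) * (u1 + u2) * (v1 + v2) - (u2 + v2) * (u2 + v1) * (u1 + v2)) /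
          (u1 + v1 - u2 - v2).
have gen i : (i < 6)%N -> C4_gens`_i \in adjoin k C4_gens.
  by move=> lti; apply: adjoin_nth.
have S_in : S \in adjoin k C4_gens := gen 0%N isT.
have D_in : D \in adjoin k C4_gens := gen 1%N isT.
have B_in : B \in adjoin k C4_gens := gen 2%N isT.
have C_in : C \in adjoin k C4_gens := gen 3%N isT.
have {fL} fE : f \in adjoin k (p1 :: C4_gens).
  pose rho2 : {rmorphism L -> L} := rho \o rho.
  have rho2h : rho2 h = v1 + v2 by rewrite /= !rmorphD /= ru1 ru2 rv1.
  have gens2 : all (fun x => rho2 x == x) C4_gens.
    by apply/allP=> x /(allP C4_gens_fixed)/eqP rx; rewrite /= !rx.
  have rho2f : rho2 f = f by rewrite /= !rf.
  apply: (quadratic_descent (sigma := rho2) (b := h)) rho2f fL; rewrite ?rho2h.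
  - by move=> c kc; rewrite /= !rk.
  - apply/andP; split.
      by rewrite /= !rmorphD /= ru1 rv1 ru2 rv2 addrC.
    exact: gens2.
  - by rewrite eq_sym -subr_eq0 opprD addrA.
  - have -> : h + (v1 + v2) = S by rewrite /h /S; ring.
    exact: adjoin_up.
  - have -> : h * (v1 + v2) = C + (S - p1) * D.
      by rewrite /h /S /p1 /C /D; field.
    have p1_up : p1 \in adjoin k (p1 :: C4_gens) by apply: adjoin_head.
    have S_up : S \in adjoin k (p1 :: C4_gens) by apply: adjoin_up.
    have C_up : C \in adjoin k (p1 :: C4_gens) by apply: adjoin_up.
    have D_up : D \in adjoin k (p1 :: C4_gens) by apply: adjoin_up.
    by field_mem.
  set F := adjoin k _.
  have p1F : p1 \in F by apply/adjoin_up/adjoin_head.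
  have hF : h \in F by apply: adjoin_head.
  have SF : S \in F by do 2!apply: adjoin_up.
  have BF : B \in F by do 2!apply: adjoin_up.
  have den : S - 2 * h != 0.
    have -> : S - 2 * h = - (u1 + u2 - v1 - v2) by rewrite /S /h; ring.
    by rewrite oppr_eq0.
  have u1F : u1 \in F.
    have -> : u1 = (B * (2 * p1 - S) + h * (S - p1 - h)) / (S - 2 * h).
      by apply: (mulIf den); rewrite divfK // /S /B /p1 /h; field.
    by field_mem.
  have v1F : v1 \in F by have -> : v1 = p1 - u1 by [rewrite /p1; ring]; field_mem.
  have u2F : u2 \in F by have -> : u2 = h - u1 by [rewrite /h; ring]; field_mem.
  have v2F : v2 \in F.
    by have -> : v2 = S - u1 - v1 - u2 by [rewrite /S; ring]; field_mem.
  have [||||s1F s2F] := @linear_gens_solve F; try by field_mem.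
  + by do 2!apply: adjoin_up; apply: (gen 4%N).
  + by do 2!apply: adjoin_up; apply: (gen 5%N).
  by rewrite /= u1F v1F u2F v2F s1F s2F.
have p1C : rho p1 = u2 + v2 by rewrite rmorphD /= ru1 rv1.
apply: (quadratic_descent (sigma := rho) (b := p1)) rf fE => //; rewrite ?p1C.
- exact: C4_gens_fixed.
- by rewrite eq_sym -subr_eq0 opprD addrA.
- by have -> : p1 + (u2 + v2) = S by [rewrite /p1 /S; ring].
- have den : (S - 4 * B) ^+ 2 + 4 * D ^+ 2 != 0.
    have -> : (S - 4 * B) ^+ 2 + 4 * D ^+ 2 =
        ((u1 - v1) ^+ 2 + (u2 - v2) ^+ 2) ^+ 2 / (u1 + v1 - u2 - v2) ^+ 2.
      by rewrite /S /B /D; field.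
    by rewrite mulf_neq0 ?invr_neq0 ?expf_neq0.
  have -> : p1 * (u2 + v2) =
      (4 * S ^+ 2 * B ^+ 2 - 2 * S ^+ 3 * B - 4 * C ^+ 2 + D * S ^+ 3
       + 2 * S ^+ 2 * C - 4 * D * S * C) / ((S - 4 * B) ^+ 2 + 4 * D ^+ 2).
    by apply: (mulIf den); rewrite divfK // /p1 /S /B /C /D; field.
  by field_mem.
exact: adjoin_all.
Qed.

End Cyclic.
Section Dihedral.

Variables alpha beta omega : {rmorphism L -> L}.
Hypotheses (au1 : alpha u1 = v1) (av1 : alpha v1 = u1)
  (au2 : alpha u2 = u2) (av2 : alpha v2 = v2)
  (as1 : alpha s1 = s1) (as2 : alpha s2 = s2).
Hypotheses (bu1 : beta u1 = u1) (bv1 : beta v1 = v1)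
  (bu2 : beta u2 = v2) (bv2 : beta v2 = u2)
  (bs1 : beta s1 = s1) (bs2 : beta s2 = s2).
Hypotheses (wu1 : omega u1 = u2) (wv1 : omega v1 = v2)
  (wu2 : omega u2 = u1) (wv2 : omega v2 = v1)
  (ws1 : omega s1 = s2) (ws2 : omega s2 = s1).
Hypotheses (ak : {in k, forall c, alpha c = c})
  (bk : {in k, forall c, beta c = c}) (wk : {in k, forall c, omega c = c}).
Hypotheses (uv1 : u1 != v1) (uv2 : u2 != v2).

Let D4_gens := pair_gens (u1 + v1) (u2 + v2) (u1 * v1) (u2 * v2) s1 s2.

Lemma D4_gens_fixed : [/\ all (fun x => alpha x == x) D4_gens,
  all (fun x => beta x == x) D4_gens & all (fun x => omega x == x) D4_gens].
Proof.
split; [apply: pair_gens_stable | apply: pair_gens_stable | apply: pair_gens_fixed];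
  rewrite ?rmorphD ?rmorphM /= ?(au1, av1, au2, av2, bu1, bv1, bu2, bv2)
    ?(wu1, wv1, wu2, wv2) //; by [rewrite addrC | rewrite mulrC].
Qed.

(** The two flips replace u1, v1 and u2, v2 by their sums and products, which form pairs
    exchanged by omega. *)
Lemma D4_generators f : alpha f = f -> beta f = f -> omega f = f ->
    f \in adjoin k [:: u1; v1; u2; v2; s1; s2] ->
  f \in adjoin k D4_gens.
Proof.
move=> af bf wf fL.
have {fL} fL : f \in adjoin k [:: u1 + v1; u1 * v1; u2; v2; s1; s2].
  set s := [:: u1 + v1; _; _; _; _; _].
  apply: (quadratic_descent (sigma := alpha) (b := u1)) af fL; rewrite ?au1 //.
  - by rewrite /= rmorphD rmorphM /= au1 av1 au2 av2 as1 as2 addrC mulrC !eqxx.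
  - by rewrite eq_sym.
  - exact: (@adjoin_nth s 0%N).
  - exact: (@adjoin_nth s 1%N).
  have u1F : u1 \in adjoin k (u1 :: s) by apply: adjoin_head.
  have p1F : u1 + v1 \in adjoin k (u1 :: s) by apply: (@adjoin_nth (u1 :: s) 1%N).
  have v1F : v1 \in adjoin k (u1 :: s).
    by have -> : v1 = u1 + v1 - u1 by [ring]; field_mem.
  have gen i : (i < 7)%N -> (u1 :: s)`_i \in adjoin k (u1 :: s).
    by move=> lti; apply: adjoin_nth.
  by rewrite /= u1F v1F (gen 3%N) ?(gen 4%N) ?(gen 5%N) ?(gen 6%N).
have {fL} fL : f \in adjoin k [:: u1 + v1; u2 + v2; u1 * v1; u2 * v2; s1; s2].
  set s := [:: u1 + v1; _; _; _; _; _].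
  apply: (quadratic_descent (sigma := beta) (b := u2)) bf fL; rewrite ?bu2 //.
  - rewrite /= !rmorphD !rmorphM /= bu1 bv1 bu2 bv2 bs1 bs2.
    by rewrite (addrC v2) (mulrC v2) !eqxx.
  - by rewrite eq_sym.
  - exact: (@adjoin_nth s 1%N).
  - exact: (@adjoin_nth s 3%N).
  have u2F : u2 \in adjoin k (u2 :: s) by apply: adjoin_head.
  have p2F : u2 + v2 \in adjoin k (u2 :: s) by apply: (@adjoin_nth (u2 :: s) 2%N).
  have v2F : v2 \in adjoin k (u2 :: s).
    by have -> : v2 = u2 + v2 - u2 by [ring]; field_mem.
  have gen i : (i < 7)%N -> (u2 :: s)`_i \in adjoin k (u2 :: s).
    by move=> lti; apply: adjoin_nth.
  by rewrite /= u2F v2F (gen 1%N) ?(gen 3%N) ?(gen 5%N) ?(gen 6%N).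
apply: (pair_generators (sigma := omega)) wf fL => //;
  rewrite ?rmorphD ?rmorphM /= ?wu1 ?wu2 ?wv1 ?wv2 //.
by rewrite -subr_eq0 opprD addrA.
Qed.

End Dihedral.

End Quadruple.
End Generators.

(** * The fixed fields of the imprimitive groups *)

(** Non-vanishing of a polynomial in independent elements, tested at a point. *)
Lemma value_neq0 (K L : fieldType) (iota : {rmorphism K -> L}) n (t : 'I_n -> L)
    (p : {mpoly K[n]}) (v : 'I_n -> K) :
  algebraically_independent iota t -> p.@[v] != 0 -> mmap iota t p != 0.
Proof.
move=> ind; apply: contraNneq => /ind->.
by rewrite meval0.
Qed.

Section Nonvanishing.

Variables (K L : fieldType) (iota : {rmorphism K -> L}) (t : 'I_6 -> L).
Hypothesis ind : algebraically_independent iota t.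

Lemma independent_sum a b c d : b != a -> c != a -> d != a ->
  t a + t b - t c - t d != 0.
Proof.
move=> ba ca da; have := @value_neq0 _ _ _ _ _
  ('X_a + 'X_b - 'X_c - 'X_d : {mpoly K[6]}) (fun i => (i == a)%:R) ind.
rewrite !(mevalB, mevalD, mevalXU) eqxx (negPf ba) (negPf ca) (negPf da).
rewrite !(addr0, subr0) oner_eq0 => /(_ isT).
by rewrite !(rmorphB, rmorphD) /= !mmapX !mmap1U.
Qed.

Lemma independent_squares a b c d : b != a -> c != a -> d != a ->
  (t a - t b) ^+ 2 + (t c - t d) ^+ 2 != 0.
Proof.
move=> ba ca da; have := @value_neq0 _ _ _ _ _
  (('X_a - 'X_b) * ('X_a - 'X_b) + ('X_c - 'X_d) * ('X_c - 'X_d) : {mpoly K[6]})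
  (fun i => (i == a)%:R) ind.
rewrite !(mevalB, mevalD, mevalM, mevalXU) eqxx (negPf ba) (negPf ca) (negPf da).
rewrite !(mulr0, mulr1, addr0, subr0) oner_eq0 => /(_ isT).
by rewrite !(rmorphB, rmorphD, rmorphM) /= !mmapX !mmap1U -!expr2.
Qed.

Lemma independent_neq i j : i != j -> t i != t j.
Proof.
rewrite eq_sym => /negPf ji; rewrite -subr_eq0.
have := @value_neq0 _ _ _ _ _ ('X_i - 'X_j : {mpoly K[6]}) (fun l => (l == i)%:R) ind.
rewrite mevalB !mevalXU eqxx ji subr0 oner_eq0 => /(_ isT).
by rewrite rmorphB /= !mmapX !mmap1U.
Qed.

End Nonvanishing.

Section SixVariables.

Variable K : fieldType.
Local Notation L := (ratfun K 6).
Local Notation k := (constants (ratC K 6)).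
Local Notation x := (@ratX K 6).

Definition masuda_var (i j l : 'I_6) : L := masuda (x i) (x j) (x l).

Let u1 := masuda_var 'o_0 'o_1 'o_2.
Let v1 := masuda_var 'o_1 'o_0 'o_2.
Let u2 := masuda_var 'o_3 'o_4 'o_5.
Let v2 := masuda_var 'o_4 'o_3 'o_5.
Let s1 := x 'o_0 + x 'o_1 + x 'o_2.
Let s2 := x 'o_3 + x 'o_4 + x 'o_5.

Lemma ratperm_k s : {in k, forall c, ratperm s c = c}.
Proof. by move=> _ /constantsP[c ->]; apply: ratpermC. Qed.

Lemma ratpermx s i : ratperm s (x i) = x (s i).
Proof. exact: ratpermX. Qed.

Lemma ratperm_masuda_var s i j l : ratperm s (masuda_var i j l) = masuda_var (s i) (s j) (s l).
Proof. by rewrite /masuda_var rmorph_masuda /= !ratpermx. Qed.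

Lemma rot1_act : (ratperm rot1 u1 = u1) * (ratperm rot1 v1 = v1) * (ratperm rot1 s1 = s1) *
  (ratperm rot1 u2 = u2) * (ratperm rot1 v2 = v2) * (ratperm rot1 s2 = s2).
Proof.
do !split; rewrite ?ratperm_masuda_var ?rmorphD /= ?ratpermx ?perm_at //.
- exact: masuda_rot.
- exact: esym (masuda_rot _ _ _).
- by rewrite /s1; ring.
Qed.

Lemma rot2_act : (ratperm rot2 u1 = u1) * (ratperm rot2 v1 = v1) * (ratperm rot2 s1 = s1) *
  (ratperm rot2 u2 = u2) * (ratperm rot2 v2 = v2) * (ratperm rot2 s2 = s2).
Proof.
do !split; rewrite ?ratperm_masuda_var ?rmorphD /= ?ratpermx ?perm_at //.
- exact: masuda_rot.
- exact: esym (masuda_rot _ _ _).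
- by rewrite /s2; ring.
Qed.

Lemma flip1_act : (ratperm flip1 u1 = v1) * (ratperm flip1 v1 = u1) * (ratperm flip1 s1 = s1) *
  (ratperm flip1 u2 = u2) * (ratperm flip1 v2 = v2) * (ratperm flip1 s2 = s2).
Proof.
do !split; rewrite ?ratperm_masuda_var ?rmorphD /= ?ratpermx ?perm_at //.
by rewrite /s1; ring.
Qed.

Lemma flip2_act : (ratperm flip2 u1 = u1) * (ratperm flip2 v1 = v1) * (ratperm flip2 s1 = s1) *
  (ratperm flip2 u2 = v2) * (ratperm flip2 v2 = u2) * (ratperm flip2 s2 = s2).
Proof.
do !split; rewrite ?ratperm_masuda_var ?rmorphD /= ?ratpermx ?perm_at //.
by rewrite /s2; ring.
Qed.

Lemma swap_act : (ratperm swap u1 = u2) * (ratperm swap v1 = v2) * (ratperm swap s1 = s2) *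
  (ratperm swap u2 = u1) * (ratperm swap v2 = v1) * (ratperm swap s2 = s1).
Proof. by do !split; rewrite ?ratperm_masuda_var ?rmorphD /= ?ratpermx ?perm_at. Qed.

Lemma independent_vars : algebraically_independent (ratC K 6) x.
Proof.
apply: (spanning_independent (chain_vars K 6)); first by rewrite size_codom card_ord.
by move=> y xy; apply/algebraic_base/mem_adjoin.
Qed.

Lemma disc_form_vars i j l : j != i -> l != i -> disc_form (x i) (x j) (x l) != 0.
Proof.
move=> ji li.
pose p : {mpoly K[6]} := 'X_i * 'X_i + 'X_j * 'X_j + 'X_l * 'X_l
                         - 'X_i * 'X_j - 'X_j * 'X_l - 'X_l * 'X_i.
have := @value_neq0 _ _ _ _ _ p (fun m => (m == i)%:R) independent_vars.
rewrite /p !(mevalB, mevalD, mevalM, mevalXU) eqxx (negPf ji) (negPf li).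
rewrite !(mulr0, mul0r, mulr1, addr0, subr0) oner_neq0 => /(_ isT).
by rewrite !(rmorphB, rmorphD, rmorphM) /= !mmapX !mmap1U /disc_form !expr2.
Qed.

(** Generators of the fixed field of the two rotations, permuted by the flips and the swap. *)
Definition covariants : seq L := [:: u1; v1; u2; v2; s1; s2].

(** [masuda_generators] for one block, then for the other. *)
Lemma fixed_covariants f : ratperm rot1 f = f -> ratperm rot2 f = f ->
  f \in adjoin k covariants.
Proof.
move=> f1 f2.
have f0 : f \in adjoin k [:: x 'o_0, x 'o_1, x 'o_2 & [:: x 'o_3; x 'o_4; x 'o_5]].
  apply: adjoin_sub (ratfun_generated f) => y; first exact: sub_adjoin.
  case/codomP=> i ->; apply: mem_adjoin.
  by have := map_f x (mem_points i).
have Ux i j l : uniq [:: i; j; l] -> uniq [:: x i; x j; x l].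
  by move=> ?; rewrite -[[:: _; _; _]]/(map x [:: i; j; l]) map_inj_uniq //; apply: ratX_inj.
have {}f0 : f \in adjoin k [:: s1, u1, v1 & [:: x 'o_3; x 'o_4; x 'o_5]].
  apply: (masuda_generators (sigma := ratperm rot1)) f1 f0.
  - exact: ratperm_k.
  - by rewrite /= !ratpermx !rot1_at !eqxx.
  - by rewrite /= ratpermx rot1_at.
  - by rewrite /= ratpermx rot1_at.
  - by rewrite /= ratpermx rot1_at.
  - exact: Ux.
  - exact: disc_form_vars.
have {}f0 : f \in adjoin k [:: x 'o_3, x 'o_4, x 'o_5 & [:: s1; u1; v1]].
  apply: adjoin_sub f0 => y; first exact: sub_adjoin.
  by move=> sy; apply: mem_adjoin; move: sy; rewrite (mem_cat _ [:: s1; u1; v1]) orbC -mem_cat.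
have {}f0 : f \in adjoin k [:: s2, u2, v2 & [:: s1; u1; v1]].
  apply: (masuda_generators (sigma := ratperm rot2)) f2 f0.
  - exact: ratperm_k.
  - by rewrite /= !rot2_act !eqxx.
  - by rewrite /= ratpermx rot2_at.
  - by rewrite /= ratpermx rot2_at.
  - by rewrite /= ratpermx rot2_at.
  - exact: Ux.
  - exact: disc_form_vars.
apply: adjoin_sub f0; first exact: sub_adjoin.
have gen i : (i < 6)%N -> covariants`_i \in adjoin k covariants.
  by move=> lti; apply: adjoin_nth.
apply/allP; apply/and5P; split.
- exact: (gen 5%N isT).
- exact: (gen 2%N isT).
- exact: (gen 3%N isT).
- exact: (gen 4%N isT).
- by apply/and3P; split; [exact: (gen 0%N isT) | exact: (gen 1%N isT) |].
Qed.

(** The six covariants generate the fixed field of the group of rotations, over which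
    the variables are algebraic. *)
Lemma independent_covariants :
  algebraically_independent (ratC K 6) (fun i : 'I_6 => covariants`_i).
Proof.
apply: (spanning_independent (chain_vars K 6)); first by rewrite size_codom card_ord.
move=> y _; pose N := <<[set rot1; rot2]>>%G.
apply: algebraicS (algebraic_fixed N y) => f /fixedP fN.
have f12 r : r \in [set rot1; rot2] -> ratperm r f = f by move=> ?; apply/fN/mem_gen.
have := fixed_covariants (f12 _ (set21 _ _)) (f12 _ (set22 _ _)).
apply: adjoin_sub => w; first exact: sub_adjoin.
move=> /(nthP 0)[i lti <-]; apply/mem_adjoin/codomP.
by exists (Ordinal lti).
Qed.

Lemma nonzero_P : u1 + v1 - u2 - v2 != 0.
Proof. exact: (independent_sum (a := 'o_0) (b := 'o_1) (c := 'o_2) (d := 'o_3)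
  independent_covariants). Qed.

Lemma nonzero_Q : u1 + u2 - v1 - v2 != 0.
Proof. exact: (independent_sum (a := 'o_0) (b := 'o_2) (c := 'o_1) (d := 'o_3)
  independent_covariants). Qed.

Lemma nonzero_R : u1 + v2 - v1 - u2 != 0.
Proof. exact: (independent_sum (a := 'o_0) (b := 'o_3) (c := 'o_1) (d := 'o_2)
  independent_covariants). Qed.

Lemma covariants_neq (i j : 'I_6) : i != j -> covariants`_i != covariants`_j.
Proof. exact: (independent_neq independent_covariants). Qed.

Lemma rotations_fix g f : g \in [:: rot1; rot2] -> f \in adjoin k covariants ->
  ratperm g f = f.
Proof.
move=> gr; apply: (fixes_adjoin (sigma := ratperm g)); first exact: ratperm_k.
move=> y; have: all (fun y => ratperm g y == y) covariants; last first.
  by move/allP=> cov /cov/eqP.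
by move: gr; rewrite !inE => /orP[]/eqP->; rewrite /= ?rot1_act ?rot2_act !eqxx.
Qed.

Lemma covariants_in (i : 'I_6) : covariants`_i \in adjoin k covariants.
Proof. exact: adjoin_nth. Qed.

Let u1k : u1 \in adjoin k covariants := covariants_in 'o_0.
Let v1k : v1 \in adjoin k covariants := covariants_in 'o_1.
Let u2k : u2 \in adjoin k covariants := covariants_in 'o_2.
Let v2k : v2 \in adjoin k covariants := covariants_in 'o_3.
Let s1k : s1 \in adjoin k covariants := covariants_in 'o_4.
Let s2k : s2 \in adjoin k covariants := covariants_in 'o_5.

Lemma generates_rotations (A : seq 'S_6) (s : seq L) :
    all (mem (adjoin k covariants)) s ->
    {in A, forall h, all (fun y => ratperm h y == y) s} ->
    (forall f, f \in adjoin k covariants -> {in A, forall h, ratperm h f = f} ->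
      f \in adjoin k s) ->
  generates <<[set y in [:: rot1, rot2 & A]]>>%g s.
Proof.
move=> /allP sk sA genA; apply: generates_gen => [h|f fA].
  rewrite !in_cons orbA => /orP[hr|/sA //]; apply/allP=> y sy; apply/eqP.
  by apply: rotations_fix (sk y sy); rewrite ?inE.
apply: genA.
  by apply: fixed_covariants; apply: fA; rewrite !in_cons eqxx ?orbT.
by move=> h Ah; apply: fA; rewrite !in_cons Ah !orbT.
Qed.

Lemma generates_swap :
  generates <<[set y in [:: rot1; rot2; swap]]>>%g (pair_gens u1 u2 v1 v2 s1 s2).
Proof.
apply: generates_rotations => [|h|f fk fA].
- exact: pair_gens_sub.
- rewrite inE => /eqP->; apply: (pair_gens_fixed (sigma := ratperm swap));
    by rewrite /= swap_act.
apply: (pair_generators (sigma := ratperm swap)); first exact: ratperm_k.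
1-6: by rewrite /= swap_act.
- exact: (@covariants_neq 'o_0 'o_2).
- by apply: fA; rewrite inE.
set s := [:: u1; _; _; _; _; _].
have gen i : (i < 6)%N -> s`_i \in adjoin k s by move=> lti; apply: adjoin_nth.
apply: adjoin_sub fk; first exact: sub_adjoin.
apply/allP; apply/and5P; split.
- exact: (gen 0%N isT).
- exact: (gen 2%N isT).
- exact: (gen 1%N isT).
- exact: (gen 3%N isT).
- by apply/and3P; split; [exact: (gen 4%N isT) | exact: (gen 5%N isT) |].
Qed.

Let flip_swap : 'S_6 := (flip1 * flip2 * swap)%g.

Lemma flip_swap_act : (ratperm flip_swap u1 = v2) * (ratperm flip_swap v2 = u1) *
  (ratperm flip_swap v1 = u2) * (ratperm flip_swap u2 = v1) *
  (ratperm flip_swap s1 = s2) * (ratperm flip_swap s2 = s1).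
Proof. by do !split; rewrite !ratpermM ?flip1_act ?flip2_act ?swap_act. Qed.

Lemma generates_flip_swap :
  generates <<[set y in [:: rot1; rot2; flip_swap]]>>%g (pair_gens u1 v2 v1 u2 s1 s2).
Proof.
apply: generates_rotations => [|h|f fk fA].
- exact: pair_gens_sub.
- rewrite inE => /eqP->; apply: (pair_gens_fixed (sigma := ratperm flip_swap));
    by rewrite /= flip_swap_act.
apply: (pair_generators (sigma := ratperm flip_swap)); first exact: ratperm_k.
1-6: by rewrite /= flip_swap_act.
- exact: (@covariants_neq 'o_0 'o_3).
- by apply: fA; rewrite inE.
set s := [:: u1; _; _; _; _; _].
have gen i : (i < 6)%N -> s`_i \in adjoin k s by move=> lti; apply: adjoin_nth.
apply: adjoin_sub fk; first exact: sub_adjoin.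
apply/allP; apply/and5P; split.
- exact: (gen 0%N isT).
- exact: (gen 2%N isT).
- exact: (gen 3%N isT).
- exact: (gen 1%N isT).
- by apply/and3P; split; [exact: (gen 4%N isT) | exact: (gen 5%N isT) |].
Qed.

Lemma flips_act : (ratperm (flip1 * flip2)%g u1 = v1) * (ratperm (flip1 * flip2)%g v1 = u1) *
  (ratperm (flip1 * flip2)%g u2 = v2) * (ratperm (flip1 * flip2)%g v2 = u2) *
  (ratperm (flip1 * flip2)%g s1 = s1) * (ratperm (flip1 * flip2)%g s2 = s2).
Proof. by do !split; rewrite ratpermM ?flip1_act ?flip2_act. Qed.

Lemma generates_Klein :
  generates <<[set y in [:: rot1; rot2; (flip1 * flip2)%g; swap]]>>%g (V4_gens u1 v1 u2 v2 s1 s2).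
Proof.
apply: generates_rotations => [|h|f fk fA].
- exact: V4_gens_sub.
- rewrite !inE => /orP[]/eqP->.
    by apply: (V4_gens_fixed1 (alpha := ratperm (flip1 * flip2)%g)); rewrite /= flips_act.
  by apply: (V4_gens_fixed2 (omega := ratperm swap)); rewrite /= swap_act.
apply: (V4_generators nonzero_P nonzero_Q (alpha := ratperm (flip1 * flip2)%g)
  (omega := ratperm swap)) fk.
1-6: by rewrite /= flips_act.
1-6: by rewrite /= swap_act.
- exact: ratperm_k.
- exact: ratperm_k.
- exact: nonzero_R.
- by apply: fA; rewrite !inE eqxx.
- by apply: fA; rewrite !inE eqxx orbT.
Qed.

Lemma flip1_swap_act : (ratperm (flip1 * swap)%g u1 = v2) * (ratperm (flip1 * swap)%g v2 = v1) *
  (ratperm (flip1 * swap)%g v1 = u2) * (ratperm (flip1 * swap)%g u2 = u1) *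
  (ratperm (flip1 * swap)%g s1 = s2) * (ratperm (flip1 * swap)%g s2 = s1).
Proof. by do !split; rewrite ratpermM ?flip1_act ?swap_act. Qed.

Lemma generates_cyclic :
  generates <<[set y in [:: rot1; rot2; (flip1 * swap)%g]]>>%g (C4_gens u1 v1 v2 u2 s1 s2).
Proof.
(* flip1 * swap permutes u1 -> v2 -> v1 -> u2 -> u1, so v2 and u2 change places *)
have ind := independent_covariants.
have P0 : u1 + v1 - v2 - u2 != 0.
  exact: (independent_sum (a := 'o_0) (b := 'o_1) (c := 'o_3) (d := 'o_2) ind).
have Q0 : u1 + v2 - v1 - u2 != 0.
  exact: (independent_sum (a := 'o_0) (b := 'o_3) (c := 'o_1) (d := 'o_2) ind).
have N0 : (u1 - v1) ^+ 2 + (v2 - u2) ^+ 2 != 0.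
  exact: (independent_squares (a := 'o_0) (b := 'o_1) (c := 'o_3) (d := 'o_2) ind).
apply: generates_rotations => [|h|f fk fA].
- exact: C4_gens_sub.
- rewrite inE => /eqP->.
  by apply: (C4_gens_fixed (rho := ratperm (flip1 * swap)%g)); rewrite /= flip1_swap_act.
apply: (C4_generators P0 Q0 (rho := ratperm (flip1 * swap)%g)).
1-6: by rewrite /= flip1_swap_act.
- exact: ratperm_k.
- exact: N0.
- by apply: fA; rewrite inE.
set s := [:: u1; _; _; _; _; _].
have gen i : (i < 6)%N -> s`_i \in adjoin k s by move=> lti; apply: adjoin_nth.
apply: adjoin_sub fk; first exact: sub_adjoin.
apply/allP; apply/and5P; split.
- exact: (gen 0%N isT).
- exact: (gen 1%N isT).
- exact: (gen 3%N isT).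
- exact: (gen 2%N isT).
- by apply/and3P; split; [exact: (gen 4%N isT) | exact: (gen 5%N isT) |].
Qed.

Lemma generates_dihedral :
  generates <<[set y in [:: rot1; rot2; flip1; flip2; swap]]>>%g
    (pair_gens (u1 + v1) (u2 + v2) (u1 * v1) (u2 * v2) s1 s2).
Proof.
apply: generates_rotations => [|h|f fk fA].
- by apply: pair_gens_sub; field_mem.
- have [||||||||||||||||||Da Db Dw] := @D4_gens_fixed _ u1 v1 u2 v2 s1 s2
    (ratperm flip1) (ratperm flip2) (ratperm swap).
  1-18: by rewrite /= ?flip1_act ?flip2_act ?swap_act.
  rewrite !in_cons in_nil orbF => /or3P[] /eqP->.
  + exact: Da.
  + exact: Db.
  + exact: Dw.
have [fAa fAb fAw] : [/\ ratperm flip1 f = f, ratperm flip2 f = f & ratperm swap f = f].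
  by split; apply: fA; rewrite !inE eqxx ?orbT.
apply: (D4_generators nonzero_P (alpha := ratperm flip1) (beta := ratperm flip2)
  (omega := ratperm swap)) fk.
1-6: by rewrite /= flip1_act.
1-6: by rewrite /= flip2_act.
1-6: by rewrite /= swap_act.
1-3: exact: ratperm_k.
- exact: (@covariants_neq 'o_0 'o_1).
- exact: (@covariants_neq 'o_2 'o_3).
- exact: fAa.
- exact: fAb.
- exact: fAw.
Qed.

Theorem imprimitive_generates A : A \in imprimitive_generators ->
  exists2 s : seq L, size s = 6%N & generates <<[set y in A]>>%g s.
Proof.
rewrite /imprimitive_generators !in_cons in_nil orbF => /or4P[/eqP->|/eqP->|/eqP->|].
- by exists (pair_gens u1 u2 v1 v2 s1 s2); last exact: generates_swap.
- by exists (pair_gens u1 v2 v1 u2 s1 s2); last exact: generates_flip_swap.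
- by exists (V4_gens u1 v1 u2 v2 s1 s2); last exact: generates_Klein.
case/orP=> /eqP->; first by exists (C4_gens u1 v1 v2 u2 s1 s2); last exact: generates_cyclic.
by exists (pair_gens (u1 + v1) (u2 + v2) (u1 * v1) (u2 * v2) s1 s2);
  last exact: generates_dihedral.
Qed.

End SixVariables.

Theorem theorem1p1 (K : fieldType) (G : {group 'S_6})
    (transG : [transitive G, on [set: 'I_6] | 'P])
    (C3xC3 : exists2 H : {group 'S_6},
       H \subset G & H \isog [set: 'Z_3 * 'Z_3])
    (neqA6 : G <> ('Alt_('I_6))%g :> {set 'S_6}) :
  rational_over (ratC K 6) (fixed_ratfun K G).
Proof.
case: (transitive_classification transG C3xC3) => [//|defG|[r [A [Agen defG]]]].
  apply: (@rational_of_generators K 6 G); last by rewrite defG; apply: symmetric_generates.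
  by rewrite size_codom card_ord.
have [s ss gen] := imprimitive_generates K Agen.
have genG : generates G (map (ratperm r^-1%g) s).
  by apply: generates_conj; rewrite defG.
by apply: rational_of_generators genG; rewrite size_map.
Qed.
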